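(* Given any number of measurement settings $m=2^x$ ($m\ge 2$, $x$ an integer), the local bound of the generalized Mermin expression is $$C_{m,n}=\frac{2}{m^n}\sum_{j=0}^{m/2-1}(-1)^j\,\frac{\cos\!\left(\frac{(2j+1)\pi}{2m}\right)}{\sin^{n}\!\left(\frac{(2j+1)\pi}{2m}\right)}$$ for all odd $n\ge n_m^{\mathrm{odd}}=\max\{n_m^{\mathrm{even}}+1,\;n_m^{\mathrm{odd},1},\;n_m^{\mathrm{odd},2}\}$, where $$n_m^{\mathrm{odd},1}=\left\lceil\frac{\log(16)-\log(5m^2)}{\log\!\left(\tan\frac{\pi}{8}\right)}\right\rceil,\qquad n_m^{\mathrm{odd},2}=\left\lceil\frac{\log\!\left(1-\cos\frac{\pi}{2m}\right)-\log\!\left(1+\frac54\cos\frac{\pi}{2m}\right)}{\log\!\left(\tan\frac{\pi}{8}\right)}\right\rceil,$$ and $$n_m^{\mathrm{even}}=\left\lceil 2\left(1+\frac{\log(\sqrt2)-\log\!\left(m\sin\frac{\pi}{2m}\right)}{\log\!\left(1-4\sin^2\frac{\pi}{2m}\right)}\right)\right\rceil.$$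
   Context: There are $n$ parties, each with $m$ measurement settings labelled $0,\dots,m-1$ and outcomes $\pm1$. A deterministic strategy of party $j$ is a vector $\mathbf a^{(j)}=(a^{(j)}_0,\dots,a^{(j)}_{m-1})\in\{\pm1\}^m$. For $\mathbf x=(x_1,\dots,x_n)\in\{0,\dots,m-1\}^n$ put $s(\mathbf x)=\sum_{j=1}^n x_j$ (an ordinary integer sum). The value of the generalized Mermin expression on deterministic strategies is $$\langle\mathcal M_{m,n}\rangle_{\mathbf a^{(1)},\dots,\mathbf a^{(n)}}=\frac{1}{m^{n-1}}\sum_{\substack{\mathbf x\in\{0,\dots,m-1\}^n\\ s(\mathbf x)\equiv0\ (\mathrm{mod}\ m)}}(-1)^{s(\mathbf x)/m}\prod_{j=1}^n a^{(j)}_{x_j}.$$ The local (hidden-variable) bound is $$C_{m,n}=\max_{\mathbf a^{(1)},\dots,\mathbf a^{(n)}\in\{\pm1\}^m}\langle\mathcal M_{m,n}\rangle_{\mathbf a^{(1)},\dots,\mathbf a^{(n)}}$$ (allowing shared randomness, i.e. convex mixtures of deterministic strategies, does not change the maximum). *)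

(* Defs.v *)
From HB Require Import structures.
From mathcomp Require Import all_boot all_order all_algebra.
From mathcomp Require Import all_classical all_reals all_analysis.

Set Implicit Arguments.
Unset Strict Implicit.
Unset Printing Implicit Defensive.

Import Order.TTheory GRing.Theory Num.Theory.
Local Open Scope ring_scope.

(* The boolean [a j k] encodes the outcome [(-1) ^+ a j k] of party [j] on
   setting [k]: [false] is +1 and [true] is -1. *)
Definition strategies (m n : nat) := {ffun 'I_n -> {ffun 'I_m -> bool}}.

Definition setting_sum (m n : nat) (x : {ffun 'I_n -> 'I_m}) : nat :=
  (\sum_(j < n) x j)%N.

(* Meaningful for [0 < n]; [n.-1] is truncated at [n = 0]. *)
Definition mermin (R : realType) (m n : nat) (a : strategies m n) : R :=
  (m%:R ^+ n.-1)^-1 *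
  \sum_(x : {ffun 'I_n -> 'I_m} | (m %| setting_sum x)%N)
     (-1) ^+ (setting_sum x %/ m)%N * \prod_(j < n) (-1) ^+ (a j (x j)).

(* The maximum over the finite type [strategies m n]; the all-(+1) strategy
   only witnesses that this type is inhabited. *)
Definition local_bound (R : realType) (m n : nat) : R :=
  mermin R [arg max_(a > [ffun=> [ffun=> false]] : strategies m n)
              mermin R a]%O.

(* For [m = 2] the quotient is, on paper, 0 / log(-1), i.e. 0, so that
   [n_even R 2 = 2].  Here [ln] is 0 on nonpositive reals and division by 0
   gives 0, hence the value is the same. *)
Definition n_even (R : realType) (m : nat) : int :=
  Num.ceil (2 * (1 + (ln (Num.sqrt 2) - ln (m%:R * sin (pi / (2 * m%:R))))
                     / ln (1 - 4 * sin (pi / (2 * m%:R)) ^+ 2)) : R).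

Definition n_odd1 (R : realType) (m : nat) : int :=
  Num.ceil ((ln 16 - ln (5 * m%:R ^+ 2)) / ln (tan (pi / 8)) : R).

Definition n_odd2 (R : realType) (m : nat) : int :=
  Num.ceil ((ln (1 - cos (pi / (2 * m%:R)))
             - ln (1 + 5 / 4 * cos (pi / (2 * m%:R))))
            / ln (tan (pi / 8)) : R).

Definition n_odd (R : realType) (m : nat) : int :=
  Num.max (n_even R m + 1) (Num.max (n_odd1 R m) (n_odd2 R m)).

(* Main.v *)
(* Put y = pi / (2 m).  By the discrete Fourier transform, the Mermin value is
   m^-n times the sum over the odd h < 2 m of the products of F_j(h), where F_j is
   the polynomial with coefficients a^(j) evaluated at exp(i pi h / m), a root of
   z^m = -1.  At each h either |F_j(h)| <= (1 - 4 sin^2 y) / sin y, or F_j is up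
   to a rotation the conjugate peaking at h of the polynomial of the constant
   strategy, with |F_j(h)| = 1 / sin y: a sign vector whose sum of unit vectors is
   not a full half-plane fan loses a definite amount, and the Galois group
   permutes the roots of z^m = -1 because m is a power of 2.
   If all parties peak at a common h, the value is an explicit sum depending on one
   odd integer P, whose leading term 2 cos(P y) / sin^n y is largest for
   P = +-1 mod 4 m, giving the formula, and otherwise at most
   2 cos(3 y) / sin^n y.  If some party peaks nowhere, AM-GM on the n - 1 others
   together with Parseval's identity (this is where n_even enters) bounds the
   value; if all parties peak but at different places, every product contains a
   factor that is smaller than its maximum by tan(pi / 8). *)
Require Import Defs.
From HB Require Import structures.
From mathcomp Require Import all_boot all_order all_algebra.
From mathcomp Require Import all_classical all_reals all_analysis.
From mathcomp Require Import complex ring lra zify.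

Set Implicit Arguments.
Unset Strict Implicit.
Unset Printing Implicit Defensive.
Import Order.TTheory GRing.Theory Num.Theory.
Local Open Scope ring_scope.

(** * Exponentials and periodic sums *)

Definition expi (R : realType) (t : R) : R[i] := Complex (cos t) (sin t).

Lemma expi0 (R : realType) : expi (0 : R) = 1.
Proof. by rewrite /expi cos0 sin0. Qed.

Lemma expiD (R : realType) (s t : R) : expi (s + t) = expi s * expi t.
Proof. by rewrite /expi cosD sinD /=; apply/eqP; rewrite eq_complex /= eqxx [_ * cos t]mulrC addrC mulrC [cos s * _]mulrC !eqxx. Qed.

Lemma expi_pi (R : realType) : expi (pi : R) = -1.
Proof. by rewrite /expi cospi sinpi; apply/eqP; rewrite eq_complex /= oppr0 !eqxx. Qed.

Lemma expiX (R : realType) (t : R) n : expi (n%:R * t) = expi t ^+ n.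
Proof.
elim: n => [|n IHn]; first by rewrite mul0r expi0.
by rewrite -natr1 mulrDl mul1r expiD IHn exprSr.
Qed.

Lemma expi_pi_nat (R : realType) n : expi (n%:R * pi : R) = (-1) ^+ n.
Proof. by rewrite expiX expi_pi. Qed.

Lemma expi_sum (R : realType) (I : finType) (F : I -> R) :
  expi (\sum_i F i) = \prod_i expi (F i).
Proof. by apply: big_morph; [exact: expiD | exact: expi0]. Qed.

Lemma normc_expi (R : realType) (t : R) : Normc.normc (expi t) = 1.
Proof. by rewrite /expi /= cos2Dsin2 sqrtr1. Qed.

Lemma normc_prod (R : realType) (I : finType) (P : pred I) (F : I -> R[i]) :
  Normc.normc (\prod_(i | P i) F i) = \prod_(i | P i) Normc.normc (F i).
Proof. by apply: big_morph; [exact: Normc.normcM | exact: Normc.normc1]. Qed.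

Lemma normc_ge0 (R : realType) (z : R[i]) : 0 <= Normc.normc z.
Proof. by case: z => a b; exact: sqrtr_ge0. Qed.

Lemma normc_sqr (R : realType) (z : R[i]) :
  Normc.normc z ^+ 2 = complex.Re z ^+ 2 + complex.Im z ^+ 2.
Proof. by case: z => a b /=; rewrite sqr_sqrtr // addr_ge0 ?sqr_ge0. Qed.

Lemma Re_le_normc (R : realType) (z : R[i]) : complex.Re z <= Normc.normc z.
Proof.
case: z => a b /=; rewrite (le_trans (ler_norm a)) // -sqrtr_sqr ler_wsqrtr //.
by rewrite lerDl sqr_ge0.
Qed.

Lemma Re_sum (R : realType) (I : finType) (P : pred I) (F : I -> R[i]) :
  complex.Re (\sum_(i | P i) F i) = \sum_(i | P i) complex.Re (F i).
Proof. by apply: big_morph => // -[a b] [c d]. Qed.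

Lemma Re_signM (R : realType) n (z : R[i]) :
  complex.Re ((-1) ^+ n * z) = (-1) ^+ n * complex.Re z.
Proof.
elim: n => [|n IHn]; first by rewrite !expr0 !mul1r.
by rewrite !exprS -!mulrA !mulN1r -IHn; case: (_ * z).
Qed.

Lemma Im_sum (R : realType) (I : finType) (P : pred I) (F : I -> R[i]) :
  complex.Im (\sum_(i | P i) F i) = \sum_(i | P i) complex.Im (F i).
Proof. by apply: big_morph => // -[a b] [c d]. Qed.

Lemma Im_signM (R : realType) n (z : R[i]) :
  complex.Im ((-1) ^+ n * z) = (-1) ^+ n * complex.Im z.
Proof.
elim: n => [|n IHn]; first by rewrite !expr0 !mul1r.
by rewrite !exprS -!mulrA !mulN1r -IHn; case: (_ * z).
Qed.

Lemma cosD2piMn (R : realType) (t : R) n : cos (t + n%:R * (2 * pi)) = cos t.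
Proof.
rewrite -(periodicn (@cosD2pi R) n t); congr (cos (t + _)).
by rewrite -[(pi *+ 2) *+ n]mulr_natl -[pi *+ 2]mulr_natl.
Qed.

Lemma cosDpiMn (R : realType) (t : R) n :
  cos (t + n%:R * pi) = (-1) ^+ n * cos t.
Proof.
elim: n => [|n IHn]; first by rewrite mul0r addr0 mul1r.
by rewrite -natr1 mulrDl mul1r addrA cosDpi IHn exprS mulN1r mulNr.
Qed.

(** [c] is invertible modulo [m], so the affine map permutes the residues. It serves translations
    ([c = 1]) and dilations ([d = 0]). *)
Lemma sum_periodic_affine (V : zmodType) (m c d : nat) (phi : nat -> V) :
  coprime c m -> (forall k, phi (k + m)%N = phi k) ->
  \sum_(k < m) phi (c * k + d)%N = \sum_(k < m) phi k.
Proof.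
case: m => [|m] cop per; first by rewrite !big_ord0.
have perM q k : phi (k + q * m.+1)%N = phi k.
  elim: q => [|q IHq]; first by rewrite mul0n addn0.
  by rewrite mulSn addnCA addnC per IHq.
have phimod k : phi (k %% m.+1)%N = phi k.
  by rewrite [in RHS](divn_eq k m.+1) addnC perM.
pose h (k : 'I_m.+1) : 'I_m.+1 := inord ((c * k + d) %% m.+1)%N.
have hE k : h k = ((c * k + d) %% m.+1)%N :> nat.
  by rewrite /h inordK // ltn_mod.
have h_inj : injective h.
  move=> i j /(congr1 val) /=; rewrite !hE => /eqP.
  rewrite eqn_modDr => /eqP eqij; apply: val_inj => /=.
  wlog le_ij : i j eqij / (i <= j)%N.
    by move=> W; case: (leqP i j) => [/W->//|/ltnW/W->].
  move/eqP: eqij; rewrite eq_sym eqn_mod_dvd ?leq_mul2l ?le_ij ?orbT //.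
  rewrite -mulnBr Gauss_dvdr ?(coprime_sym _ c) // => /dvdnP[q E].
  have lt_jm := ltn_ord j.
  by case: q E => [|q]; rewrite ?mul0n ?mulSn; lia.
rewrite [RHS](reindex_inj h_inj); apply: eq_bigr => k _.
by rewrite hE phimod.
Qed.

(** * Fourier transform of antiperiodic signs *)

Definition hstep (R : realType) (m : nat) : R := pi / (2 * m%:R).

Definition antiperiodic (m : nat) (f : nat -> bool) :=
  forall k, f (k + m)%N = ~~ f k.

(* The polynomial with coefficients (-1)^(f k) at the h-th power of exp(i pi / m);
   only odd h, i.e. the roots of z^m = -1, are relevant. *)
Definition fourier (R : realType) (m : nat) (f : nat -> bool) (h : nat) : R[i] :=
  \sum_(k < m) (-1) ^+ f k * expi (2 * hstep R m * (h * k)%:R).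

(** The antiperiodic extension of the constant strategy +1. *)
Definition ones (m k : nat) : bool := odd (k %/ m).

Lemma hstep_gt0 (R : realType) m : (0 < m)%N -> 0 < hstep R m.
Proof. by move=> m0; rewrite divr_gt0 ?pi_gt0 // mulr_gt0 ?ltr0n. Qed.

Lemma hstepM (R : realType) m : (0 < m)%N -> 2 * hstep R m * m%:R = pi.
Proof.
move=> m0; have : m%:R != 0 :> R by rewrite pnatr_eq0 -lt0n.
by rewrite /hstep => ?; field.
Qed.

Lemma expi_hstepM (R : realType) m s q : (0 < m)%N ->
  expi (2 * hstep R m * (s + q * m)%:R) = (-1) ^+ q * expi (2 * hstep R m * s%:R).
Proof.
move=> m0; rewrite -expi_pi_nat -expiD -(hstepM R m0) natrD natrM; congr expi.
ring.
Qed.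

Lemma expi_hstep_mod (R : realType) m s t : (0 < m)%N ->
  s = t %[mod 2 * m] ->
  expi (2 * hstep R m * s%:R) = expi (2 * hstep R m * t%:R).
Proof.
move=> m0; wlog le_st : s t / (s <= t)%N.
  move=> W E; case: (leqP s t) => [/W|/ltnW/W]; first exact.
  by move=> ->.
move=> /eqP; rewrite eq_sym eqn_mod_dvd // => /dvdnP[q E].
have -> : t = (s + q * 2 * m)%N by rewrite -mulnA -E subnKC.
by rewrite expi_hstepM // mulnC exprM sqrrN expr1n expr1n mul1r.
Qed.

Lemma fourier_mod (R : realType) m f h h' : (0 < m)%N ->
  h = h' %[mod 2 * m] -> fourier R m f h = fourier R m f h'.
Proof.
move=> m0 E; apply: eq_bigr => k _; congr (_ * _); apply: expi_hstep_mod => //.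
by rewrite -modnMml E modnMml.
Qed.

(** At an odd frequency the exponential changes sign over [m] steps just as [f] does. *)
Lemma fourier_term_periodic (R : realType) m f h : (0 < m)%N ->
  antiperiodic m f -> odd h -> forall k,
  (-1) ^+ f (k + m)%N * expi (2 * hstep R m * (h * (k + m))%:R) =
  (-1) ^+ f k * expi (2 * hstep R m * (h * k)%:R).
Proof.
move=> m0 fm oh k; rewrite fm mulnDr expi_hstepM // -(signr_odd _ h) oh.
by case: (f k); rewrite ?expr0 ?expr1 ?mul1r ?mulN1r ?opprK.
Qed.

Lemma fourier_shift (R : realType) m f h r : (0 < m)%N ->
  antiperiodic m f -> odd h ->
  fourier R m f h =
  expi (2 * hstep R m * (h * r)%:R) * fourier R m (fun k => f (k + r)%N) h.
Proof.
move=> m0 fm oh.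
rewrite /fourier -(@sum_periodic_affine _ m 1 r (fun k =>
  (-1) ^+ f k * expi (2 * hstep R m * (h * k)%:R))) ?coprime1n //; last first.
  exact: fourier_term_periodic.
rewrite big_distrr /=; apply: eq_bigr => k _; rewrite mul1n.
by rewrite mulnDr natrD mulrDr expiD; ring.
Qed.

(** The Galois action: dilation by [h] permutes the residues modulo [m], and its inverse [g] acts on
    the frequencies. *)
Lemma fourier_twist (R : realType) m f g h i : (0 < m)%N ->
  antiperiodic m f -> (g * h = 1 %[mod 2 * m])%N -> odd g -> odd i ->
  fourier R m (fun k => f (h * k)%N) i = fourier R m f (g * i).
Proof.
move=> m0 fm gh og oi.
have cop : coprime h m.
  have : coprime (g * h) (2 * m).
    by rewrite -coprime_modl gh coprime_modl coprime1n.
  by rewrite coprimeMl coprimeMr => /andP[_]; rewrite coprimeMr => /andP[].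
rewrite [RHS]/fourier -(@sum_periodic_affine _ m h 0 (fun k =>
  (-1) ^+ f k * expi (2 * hstep R m * (g * i * k)%:R))) //; last first.
  by apply: fourier_term_periodic; rewrite // oddM og.
apply: eq_bigr => k _; rewrite addn0; congr (_ * _); apply: expi_hstep_mod => //.
have -> : (g * i * (h * k) = (g * h) * (i * k))%N by rewrite mulnACA.
by apply/esym; rewrite -modnMml gh modnMml mul1n.
Qed.

(** A geometric series of ratio [z] with [z ^+ m = -1], so that [1 - z] times the sum is 2. *)
Lemma fourier_ones (R : realType) m h : (0 < m)%N -> odd h ->
  fourier R m (ones m) h * (sin (h%:R * hstep R m))%:C%C =
  expi (pi / 2 - h%:R * hstep R m).
Proof.
move=> m0 oh; set y := h%:R * _; set z := expi (2 * y).
have S : (1 - z) * fourier R m (ones m) h = 2.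
  have -> : fourier R m (ones m) h = \sum_(k < m) z ^+ k.
    apply: eq_bigr => k _; rewrite /ones divn_small // expr0 mul1r -expiX.
    by congr expi; rewrite natrM /y; ring.
  rewrite -[1 - z]opprB mulNr -subrX1.
  rewrite opprB -expiX.
  have -> : m%:R * (2 * y) = h%:R * pi by rewrite -(hstepM R m0) /y; ring.
  by rewrite expi_pi_nat -signr_odd oh expr1 opprK.
have E : (1 - z) * expi (pi / 2 - y) = 2 * (sin y)%:C%C.
  rewrite mulrBl mul1r -expiD.
  have -> : 2 * y + (pi / 2 - y) = y + pi / 2 by ring.
  rewrite /expi -cosN opprB cosBpihalf cosDpihalf sinDpihalf.
  rewrite -[pi / 2 - y]opprB sinN sinBpihalf opprK.
  by apply/eqP; rewrite eq_complex /=; apply/andP; split; apply/eqP; ring.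
have nz : 1 - z != 0.
  by apply/eqP => H; move: S; rewrite H mul0r => /esym/eqP; rewrite pnatr_eq0.
by apply: (mulfI nz); rewrite E mulrA S.
Qed.

(** Orthogonality of the odd frequencies, which produces both the selection rule and the sign of the
    Mermin expression. *)
Lemma sum_expi_odd (R : realType) m s : (0 < m)%N ->
  \sum_(l < m) expi (2 * hstep R m * ((2 * l + 1) * s)%:R) =
  if (m %| s)%N then m%:R * (-1) ^+ (s %/ m)%N else 0.
Proof.
move=> m0; case: ifP => [/dvdnP[q ->]|ndvd].
  rewrite mulnK //.
  transitivity (\sum_(l < m) ((-1) ^+ q : R[i])); last first.
    by rewrite sumr_const card_ord mulr_natl.
  apply: eq_bigr => l _.
  rewrite mulnA -[((_ * _) * m)%N]add0n expi_hstepM // mulr0 expi0 mulr1.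
  by rewrite -signr_odd oddM oddD oddM /= signr_odd.
set z := expi (2 * hstep R m * s%:R).
have -> : \sum_(l < m) expi (2 * hstep R m * ((2 * l + 1) * s)%:R) =
          z * \sum_(l < m) (z ^+ 2) ^+ l.
  rewrite big_distrr /=; apply: eq_bigr => l _.
  rewrite -exprM -exprS -expiX; congr expi.
  by rewrite natrM natrD -[in RHS]natr1 natrM; ring.
have S : (z ^+ 2 - 1) * \sum_(l < m) (z ^+ 2) ^+ l = 0.
  rewrite -subrX1 -exprM -expiX.
  have -> : (2 * m)%:R * (2 * hstep R m * s%:R) = (2 * s)%:R * pi.
    by rewrite -(hstepM R m0) !natrM; ring.
  by rewrite expi_pi_nat exprM sqrrN !expr1n subrr.
move/eqP: S; rewrite mulf_eq0 => /orP[|/eqP ->]; last by rewrite mulr0.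
(* [z ^+ 2 = 1] would make the sine of [2 * hstep R m * s%:R] vanish, yet after reducing [s] modulo
   [m] the angle lies strictly between 0 and pi. *)
rewrite -expiX subr_eq0 => /eqP E; exfalso.
have yE : 2%:R * (2 * hstep R m * s%:R) = (2 * hstep R m * s%:R) *+ 2.
  by rewrite mulr_natl.
move: E; rewrite yE /expi cos_mulr2n => -[].
rewrite cos2sin2 => E _.
have s0 : sin (2 * hstep R m * s%:R) = 0.
  by apply/eqP; rewrite -sqrf_eq0; apply/eqP; lra.
move: s0.
have -> : 2 * hstep R m * s%:R =
    2 * hstep R m * (s %% m)%:R + pi *+ (s %/ m).
  rewrite {1}(divn_eq s m) natrD natrM -[pi *+ _]mulr_natl -(hstepM R m0); ring.
rewrite (alternatingn (@sinDpi R)) => /eqP; rewrite mulf_eq0 signr_eq0 /=.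
apply/negP; rewrite gt_eqF // sin_gt0_pi //.
have t0 : 0 < 2 * hstep R m by rewrite mulr_gt0 ?hstep_gt0.
apply/andP; split.
  rewrite (pmulr_rgt0 _ t0) ltr0n lt0n.
  by move/negbT: ndvd; rewrite /dvdn.
by rewrite -[X in _ < X](hstepM R m0) (ltr_pM2l t0) ltr_nat ltn_mod.
Qed.

(** In the expanded double sum each diagonal pair gives [m]; the others cancel by [sum_expi_odd], as
    [m] divides no nonzero difference of indices below [m]. *)
Lemma parseval (R : realType) m f : (0 < m)%N ->
  \sum_(l < m) Normc.normc (fourier R m f (2 * l + 1)) ^+ 2 = m%:R ^+ 2.
Proof.
move=> m0; set t := 2 * hstep R m.
have E l : Normc.normc (fourier R m f (2 * l + 1)) ^+ 2 =
    \sum_(i < m) \sum_(j < m) (-1) ^+ f i * (-1) ^+ f j *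
      cos (t * ((2 * l + 1) * i)%:R - t * ((2 * l + 1) * j)%:R).
  rewrite normc_sqr /fourier Re_sum Im_sum.
  under eq_bigr do rewrite Re_signM.
  under [X in _ + X ^+ 2]eq_bigr do rewrite Im_signM.
  rewrite !expr2 !big_distrlr /= -big_split /=; apply: eq_bigr => i _.
  rewrite -big_split /=; apply: eq_bigr => j _.
  by rewrite cosB; ring.
under eq_bigr do rewrite E.
rewrite exchange_big /=.
transitivity (\sum_(i < m) (m%:R : R)); last first.
  by rewrite sumr_const card_ord expr2 mulr_natl.
apply: eq_bigr => i _; rewrite exchange_big /= (bigD1 i) //= [X in _ + X]big1.
  rewrite addr0 -[in RHS](card_ord m) -sumr_const; apply: eq_bigr => l _.
  by rewrite subrr cos0 mulr1 -expr2 sqrr_sign.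
move=> j nij; rewrite -big_distrr /=.
set d := `|i - j|%N.
have -> : \sum_(l < m) cos (t * ((2 * l + 1) * i)%:R - t * ((2 * l + 1) * j)%:R) =
   complex.Re (\sum_(l < m) expi (t * ((2 * l + 1) * d)%:R)).
  rewrite Re_sum; apply: eq_bigr => l _ /=; rewrite /d -mulrBr.
  case: (leqP j i) => [ji|/ltnW ij].
    by rewrite distnEl // mulnBr natrB // leq_mul2l ji orbT.
  rewrite distnEr // mulnBr natrB ?leq_mul2l ?ij ?orbT // -cosN -mulrN opprB.
  by [].
rewrite sum_expi_odd // ifN ?mulr0 //.
have := ltn_ord i; have := ltn_ord j; move: nij; rewrite -val_eqE /= => nij lj li.
apply/negP => /dvdnP[q]; rewrite /d.
case: (leqP j i) => [ji|/ltnW ij]; [rewrite distnEl // | rewrite distnEr //];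
  case: q => [|q]; rewrite ?mul0n ?mulSn; lia.
Qed.

(* The antiperiodic extension of a strategy, for which the multiplication of the
   polynomial by a root of z^m = -1 is a translation. *)
Definition unroll (m : nat) (a : {ffun 'I_m -> bool}) (k : nat) : bool :=
  odd (k %/ m) (+) (if insub (k %% m)%N is Some i then a i else false).

Lemma antiperiodicM m f q k : antiperiodic m f -> f (k + q * m)%N = odd q (+) f k.
Proof.
move=> fm; elim: q => [|q IHq]; first by rewrite mul0n addn0.
by rewrite mulSn addnA addnAC fm IHq /= addNb.
Qed.

Lemma antiperiodic_unroll m (a : {ffun 'I_m -> bool}) :
  (0 < m)%N -> antiperiodic m (unroll a).
Proof.
by move=> m0 k; rewrite /unroll divnDr ?divnn ?m0 ?modnDr ?oddD //= addbT addNb.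
Qed.

Lemma antiperiodic_ones m : (0 < m)%N -> antiperiodic m (ones m).
Proof. by move=> m0 k; rewrite /ones divnDr ?divnn ?m0 // oddD /= addbT. Qed.

Lemma unroll_ord m (a : {ffun 'I_m -> bool}) (i : 'I_m) : unroll a i = a i.
Proof. by rewrite /unroll divn_small // modn_small // valK. Qed.

Lemma eq_antiperiodic m f g : (0 < m)%N -> antiperiodic m f -> antiperiodic m g ->
  (forall k, (k < m)%N -> f k = g k) -> forall k, f k = g k.
Proof.
move=> m0 fm gm fg k; rewrite (divn_eq k m) addnC !antiperiodicM //.
by rewrite fg // ltn_mod.
Qed.

Lemma eq_fourier (R : realType) m f g h :
  (forall k, f k = g k) -> fourier R m f h = fourier R m g h.
Proof. by move=> fg; apply: eq_bigr => k _; rewrite fg. Qed.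

(** The product of the polynomials expands into a sum over all settings, from which [sum_expi_odd]
    selects the admissible ones; its factor [m] turns [m ^ (n - 1)] into [m ^ n]. *)
Lemma mermin_fourier (R : realType) m n (a : strategies m n) :
  (0 < m)%N -> (0 < n)%N ->
  mermin R a = (m%:R ^+ n)^-1 * complex.Re (\sum_(l < m)
    \prod_(j < n) fourier R m (unroll (a j)) (2 * l + 1)).
Proof.
move=> m0 n0.
pose sg (x : {ffun 'I_n -> 'I_m}) : R := \prod_(j < n) (-1) ^+ a j (x j).
have E : \sum_(l < m) \prod_(j < n) fourier R m (unroll (a j)) (2 * l + 1) =
  \sum_(x : {ffun 'I_n -> 'I_m} | (m %| setting_sum x)%N)
     (m%:R * ((-1) ^+ (setting_sum x %/ m)%N * sg x))%:C%C.
  rewrite [RHS]big_mkcond /=.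
  under eq_bigr do rewrite bigA_distr_bigA.
  rewrite exchange_big /=; apply: eq_bigr => x _.
  transitivity (\sum_(l < m) (sg x)%:C%C *
      expi (2 * hstep R m * ((2 * l + 1) * setting_sum x)%:R)).
    apply: eq_bigr => l _; rewrite big_split /= -expi_sum; congr (_ * _).
      rewrite rmorph_prod; apply: eq_bigr => j _.
      by rewrite unroll_ord rmorph_sign.
    by congr expi; rewrite -mulr_sumr -natr_sum -big_distrr.
  rewrite -big_distrr /= sum_expi_odd //; case: ifP => _; last by rewrite mulr0.
  by rewrite !rmorphM /= rmorph_nat rmorphXn rmorphN1 mulrC mulrA.
rewrite E Re_sum /= -mulr_sumr mulrA /mermin; congr (_ * _).
have m_neq0 : m%:R != 0 :> R by rewrite pnatr_eq0 -lt0n.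
rewrite -(prednK n0) /= exprS invfM mulrAC mulVf ?mul1r //.
Qed.

(** * Extremal sign vectors *)

Lemma sin_hstepC (R : realType) m h : (0 < m)%N -> (h <= 2 * m)%N ->
  sin ((2 * m - h)%:R * hstep R m) = sin (h%:R * hstep R m).
Proof.
move=> m0 hm; rewrite natrB // mulrBl.
have -> : (2 * m)%:R * hstep R m = pi by rewrite -(hstepM R m0) natrM; ring.
by rewrite addrC sinDpi sinN opprK.
Qed.

Lemma sin_hstep_le (R : realType) m j h : (0 < m)%N ->
  (j <= m)%N -> (j <= h)%N -> (h <= 2 * m - j)%N ->
  sin (j%:R * hstep R m) <= sin (h%:R * hstep R m).
Proof.
move=> m0 jm jh hm; wlog hm' : h jh hm / (h <= m)%N.
  move=> W; case: (leqP h m) => [|mh]; first exact: W.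
  rewrite -(sin_hstepC R m0 (_ : h <= 2 * m)%N) ?W //; lia.
have y0 := hstep_gt0 R m0.
have mE : m%:R * hstep R m = pi / 2 by rewrite -(hstepM R m0); field.
have bnd k : (k <= m)%N -> k%:R * hstep R m \in `[- (pi / 2), pi / 2]%R.
  move=> km; rewrite in_itv /=; apply/andP; split.
    rewrite (@le_trans _ _ 0) ?oppr_le0 ?divr_ge0 ?pi_ge0 //.
    by rewrite mulr_ge0 // ltW.
  by rewrite -mE ler_pM2r // ler_nat.
by rewrite leNgt ltr_sin ?bnd // -leNgt ler_pM2r // ler_nat.
Qed.

Lemma sin_hstep_gt0 (R : realType) m h : (0 < m)%N -> (0 < h < 2 * m)%N ->
  0 < sin (h%:R * hstep R m).
Proof.
move=> m0 /andP[h0 hm]; rewrite sin_gt0_pi // mulr_gt0 ?ltr0n ?hstep_gt0 //=.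
rewrite -(hstepM R m0) mulrAC -natrM ltr_pM2r ?hstep_gt0 // ltr_nat //.
Qed.

Lemma sin_hstep1_gt0 (R : realType) m : (0 < m)%N -> 0 < sin (hstep R m).
Proof.
move=> m0; have := @sin_hstep_gt0 R m 1 m0; rewrite mul1r; apply; lia.
Qed.

Lemma sin_hstep1_le (R : realType) m h : (0 < m)%N -> (0 < h < 2 * m)%N ->
  sin (hstep R m) <= sin (h%:R * hstep R m).
Proof.
move=> m0 hm; have := @sin_hstep_le R m 1 h m0; rewrite mul1r; apply; lia.
Qed.

Lemma cos_hstep1_gt0 (R : realType) m : (1 < m)%N -> 0 < cos (hstep R m).
Proof.
move=> m1; have m0 : (0 < m)%N by lia.
have y0 := hstep_gt0 R m0.
rewrite cos_gt0_pihalf //; apply/andP; split.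
  by rewrite (lt_trans _ y0) // oppr_lt0 divr_gt0 ?pi_gt0.
have -> : pi / 2 = m%:R * hstep R m by rewrite -(hstepM R m0); field.
by rewrite ltr_pMl // ltr1n.
Qed.

(** With y the half step, [c] is cos (2 y), the sine of (m - 2) y; for m >= 4 this is at least sin
    (2 y), hence at least 1 / sqrt 2. *)
Lemma cos_2hstep_ge (R : realType) m (c := 1 - 2 * sin (hstep R m) ^+ 2) :
  (3 < m)%N -> 0 <= c /\ 1 <= 2 * c ^+ 2.
Proof.
move=> m3; have m0 : (0 < m)%N by lia.
set y := hstep R m.
have cE : c = cos (2%:R * y).
  by rewrite mulr_natl cos_mulr2n cos2sin2 /c -/y mulr2n; ring.
have c_sin : c = sin ((m - 2)%:R * y).
  rewrite natrB; last by lia.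
  have -> : (m%:R - 2) * y = - (2%:R * y - pi / 2) by rewrite -(hstepM R m0) -/y; field.
  by rewrite sinN sinBpihalf opprK cE.
have s2 : 0 < sin (2%:R * y) by apply: sin_hstep_gt0 => //; lia.
have sc : sin (2%:R * y) <= c by rewrite c_sin; apply: sin_hstep_le => //; lia.
have c0 := le_trans (ltW s2) sc; split=> //.
have : sin (2%:R * y) ^+ 2 <= c ^+ 2 by rewrite ler_pXn2r // nnegrE ltW.
by have := cos2Dsin2 (2%:R * y); rewrite -cE; lra.
Qed.

Lemma gap_ge0 (R : realType) m : (3 < m)%N -> 0 <= 1 - 4 * sin (hstep R m) ^+ 2.
Proof.
by move=> m3; have [] := cos_2hstep_ge R m3; set S := sin _; nra.
Qed.

Lemma sin3x (R : realType) (y : R) : sin (3 * y) = sin y * (3 - 4 * sin y ^+ 2).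
Proof.
have -> : 3 * y = y *+ 2 + y by rewrite mulr2n; ring.
rewrite sinD sin_mulr2n cos_mulr2n cos2sin2; have := cos2Dsin2 y.
rewrite !mulr2n => E; have {}E : cos y ^+ 2 = 1 - sin y ^+ 2 by lra.
transitivity (2 * sin y * cos y ^+ 2 + (1 - 2 * sin y ^+ 2) * sin y); first by ring.
by rewrite E; ring.
Qed.

(** Cauchy-Schwarz; used with [(x, y)] the signed sum and [(a, b)] the full fan with one or two
    vectors reversed. *)
Lemma le_dot (R : realType) (x y a b q : R) : 0 <= q ->
  x ^+ 2 + y ^+ 2 <= x * a + y * b -> a ^+ 2 + b ^+ 2 <= q ^+ 2 ->
  x ^+ 2 + y ^+ 2 <= q ^+ 2.
Proof.
move=> q0; set n2 := x ^+ 2 + y ^+ 2 => H1 H2.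
have n20 : 0 <= n2 by rewrite addr_ge0 ?sqr_ge0.
have [->|n2_neq0] := eqVneq n2 0; first exact: sqr_ge0.
have n2_gt0 : 0 < n2 by rewrite lt_def n2_neq0.
rewrite -(ler_pM2l n2_gt0).
apply: (@le_trans _ _ ((x * a + y * b) ^+ 2)).
  by rewrite -expr2 ler_pXn2r // nnegrE (le_trans n20).
apply: (@le_trans _ _ (n2 * (a ^+ 2 + b ^+ 2))); last by rewrite ler_wpM2l.
rewrite -subr_ge0 /n2.
have -> : (x ^+ 2 + y ^+ 2) * (a ^+ 2 + b ^+ 2) - (x * a + y * b) ^+ 2 =
  (x * b - y * a) ^+ 2 by ring.
exact: sqr_ge0.
Qed.

(* [w k] is the projection of the k-th unit vector on the direction (X, Y) of
   the sum.  The hypothesis says that this direction lies within [y] of the axis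
   of the window, so all projections are nonnegative and every minus sign costs
   twice its projection; the signs at one end of the window are exempted since
   they only rotate it. *)
Lemma window_bound (R : realType) m (b : nat -> bool)
    (y := hstep R m)
    (X := \sum_(k < m) (-1) ^+ b k * sin ((2 * k + 1)%:R * y))
    (Y := \sum_(k < m) (-1) ^+ b k * cos ((2 * k + 1)%:R * y)) :
  (3 < m)%N -> `|Y| * cos y <= X * sin y ->
  (forall k, (0 < k < m.-1)%N -> b k = false) /\ ~~ (b 0%N && b m.-1) \/
  X ^+ 2 + Y ^+ 2 <= ((sin y)^-1 * (1 - 4 * sin y ^+ 2)) ^+ 2.
Proof.
move=> m3 HXY.
have [m0 m1 m3' m1m m1e] : [/\ (0 < m)%N, (1 < m)%N, (2 < m)%N, (m.-1 < m)%N &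
    (2 * m.-1 + 1 = 2 * m - 1)%N] by clear -m3; split; lia.
have m1_neq0 : m.-1 != 0%N by clear -m3; lia.
have m2_gt0 : (1 <= 2 * m)%N by clear -m3; lia.
have win k : (k < m)%N -> (0 < 2 * k + 1 < 2 * m)%N by clear; lia.
have int_win k : (0 < k < m.-1)%N ->
  [/\ (k < m)%N, (3 <= 2 * k + 1)%N & (2 * k + 1 <= 2 * m - 3)%N] by clear=> ?; split; lia.
have y0 : 0 < y by exact: hstep_gt0.
have s0 : 0 < sin y := sin_hstep1_gt0 R m0.
have c0 : 0 < cos y := cos_hstep1_gt0 R m1.
have s0' := ltW s0; have c0' := ltW c0.
have yX k : 2 * y * (1 * k)%:R + y = (2 * k + 1)%:R * y.
  by rewrite mul1n natrD natrM; ring.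
(* The factor [expi y] centres the fan on the imaginary axis. *)
have E1 : expi y * fourier R m (ones m) 1 = Complex 0 (sin y)^-1.
  have F := @fourier_ones R m 1 m0 isT; rewrite mul1r -/y in F.
  have sC : (sin y)%:C%C != 0 by rewrite eq_complex /= gt_eqF.
  apply: (mulIf sC); rewrite -mulrA F -expiD addrC subrK /expi cos_pihalf sin_pihalf.
  have sV : (sin y)^-1 * sin y = 1 by rewrite mulVf ?gt_eqF.
  apply/eqP; rewrite eq_complex /= sV.
  by apply/andP; split; apply/eqP; ring.
have E2 : expi y * fourier R m (ones m) 1 =
   \sum_(k < m) expi ((2 * k + 1)%:R * y).
  rewrite big_distrr /=; apply: eq_bigr => k _.
  by rewrite /ones divn_small // expr0 mul1r -expiD addrC yX.
have sumS : \sum_(k < m) sin ((2 * k + 1)%:R * y) = (sin y)^-1.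
  transitivity (complex.Im (Complex 0 (sin y)^-1)) => //.
  by rewrite -E1 E2 Im_sum.
have sumC : \sum_(k < m) cos ((2 * k + 1)%:R * y) = 0.
  transitivity (complex.Re (Complex 0 (sin y)^-1)) => //.
  by rewrite -E1 E2 Re_sum.
pose w k := X * sin ((2 * k + 1)%:R * y) + Y * cos ((2 * k + 1)%:R * y).
have w_ge0 k : (k < m)%N -> 0 <= w k.
  move=> km.
  have ck : sin y <= sin ((2 * k + 1)%:R * y).
    by apply: sin_hstep1_le => //; exact: win.
  have ck0 : 0 <= sin ((2 * k + 1)%:R * y) := le_trans s0' ck.
  have sk : `|cos ((2 * k + 1)%:R * y)| <= cos y.
    rewrite -ler_sqr ?nnegrE // real_normK ?num_real //.
    by rewrite !cos2sin2 lerD2l lerN2 ler_sqr ?nnegrE.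
  rewrite -(pmulr_rge0 _ s0) /w.
  set sk' := sin (_ * y) in ck ck0 *; set ck' := cos (_ * y) in sk *.
  have A1 : `|Y| * cos y * sk' <= X * sin y * sk' by rewrite ler_wpM2r.
  have A2 : - (Y * ck') <= `|Y| * cos y.
    by rewrite (le_trans (ler_norm _)) // normrN normrM ler_wpM2l.
  have A3 : `|Y| * cos y * sin y <= `|Y| * cos y * sk'.
    by rewrite ler_wpM2l // mulr_ge0.
  have A4 : sin y * - (Y * ck') <= sin y * (`|Y| * cos y) by rewrite ler_wpM2l.
  nra.
have sumw : \sum_(k < m) w k = X * (sin y)^-1.
  by rewrite big_split /= -!mulr_sumr sumS sumC mulr0 addr0.
have XYw : X ^+ 2 + Y ^+ 2 = \sum_(k < m) (-1) ^+ b k * w k.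
  rewrite !expr2 {2}/X {2}/Y !mulr_sumr -big_split /=.
  by apply: eq_bigr => k _; rewrite /w; ring.
have XYb : X ^+ 2 + Y ^+ 2 = X * (sin y)^-1 - 2 * \sum_(k < m | b k) w k.
  rewrite XYw -sumw mulr_sumr [X in _ - X]big_mkcond -sumrB; apply: eq_bigr => k _.
  by case: (b k); rewrite ?expr0 ?expr1; ring.
have q0 : 0 <= 1 - 4 * sin y ^+ 2 := gap_ge0 R m3.
have qS0 : 0 <= (sin y)^-1 * (1 - 4 * sin y ^+ 2) by rewrite mulr_ge0 // invr_ge0.
have Ssin : (sin y)^-1 * sin y = 1 by rewrite mulVf // gt_eqF.
case: (boolP [exists k : 'I_m, (0 < k < m.-1)%N && b k]) => [/existsP[k /andP[kint bk]]|nint].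
  (* The comparison vector is the fan with its [k]-th vector reversed; it is longest for the inner
     vectors nearest the ends, at angle 3 y from the real axis. *)
  right; apply: (@le_dot _ X Y ((sin y)^-1 - 2 * sin ((2 * k + 1)%:R * y))
    (- 2 * cos ((2 * k + 1)%:R * y))) => //.
    rewrite XYb (bigD1 k) //=.
    have : 0 <= \sum_(i < m | b i && (i != k)) w i by apply: sumr_ge0 => i _; exact: w_ge0.
    rewrite /w; set T := \sum_(i < m | _) _; set S := (sin y)^-1; lra.
  have H : sin (3%:R * y) <= sin ((2 * k + 1)%:R * y).
    by have [_ k3 k3'] := int_win _ kint; exact: sin_hstep_le.
  rewrite sin3x in H.
  rewrite exprMn sqrrB exprMn sqrrN cos2sin2.
  set sk := sin (_ * y) in H *; set S := (sin y)^-1 in Ssin *.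
  have H' : S * (sin y * (3 - 4 * sin y ^+ 2)) <= S * sk by rewrite ler_wpM2l // invr_ge0.
  have -> : (S * (1 - 4 * sin y ^+ 2)) ^+ 2 = S ^+ 2 - 8 * (S * sin y) ^+ 2 + 16 * (S * sin y) ^+ 2 * sin y ^+ 2 by ring.
  move: H'; rewrite mulrA Ssin; lra.
have int k : (0 < k < m.-1)%N -> b k = false.
  move=> kint; have [km _ _] := int_win _ kint.
  by apply/negP => bk; move/existsP: nint; apply; exists (Ordinal km); rewrite kint.
case: (boolP (b 0%N && b m.-1)) => [/andP[b0 bm]|]; last by left.
(* The two end vectors are mirror images: reversing both keeps the sum on the axis and shortens it
   by 4 sin y. *)
right; apply: (@le_dot _ X Y ((sin y)^-1 - 4 * sin y) 0) => //; last first.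
  set S := (sin y)^-1 in Ssin *.
  have -> : (S * (1 - 4 * sin y ^+ 2)) = S - 4 * (S * sin y) * sin y by ring.
  by rewrite Ssin mulr1 expr0n addr0.
rewrite XYb (bigD1 (Ordinal m0)) //= (bigD1 (Ordinal m1m)) /=; last first.
  by rewrite bm -val_eqE.
have : 0 <= \sum_(i < m | b i && (i != Ordinal m0) && (i != Ordinal m1m)) w i.
  by apply: sumr_ge0 => i _; exact: w_ge0.
have W0 : w 0%N = X * sin y + Y * cos y by rewrite /w mul1r.
have -> : w m.-1 = X * sin y - Y * cos y.
  rewrite /w m1e sin_hstepC // natrB // mulrBl.
  have -> : (2 * m)%:R * y = pi by rewrite -(hstepM R m0) natrM /y; ring.
  by rewrite mul1r cosB cospi sinpi; ring.
rewrite W0.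
set T := \sum_(i < m | _) _; set S := (sin y)^-1; lra.
Qed.

Lemma antiperiodic_comp_add m f r : antiperiodic m f ->
  antiperiodic m (fun k => f (k + r)%N).
Proof. by move=> fm k; rewrite addnAC fm. Qed.

(** Translations only rotate the sum, so the best placed one may be given to [window_bound]; a minus
    sign left at one end is removed by one more translation. *)
Lemma shift_dichotomy (R : realType) m f (s := sin (hstep R m)) :
  m = 2%N \/ (3 < m)%N -> antiperiodic m f ->
  (exists r, forall k, f (k + r)%N = ones m k) \/
  (3 < m)%N /\ Normc.normc (fourier R m f 1) <= s^-1 * (1 - 4 * s ^+ 2).
Proof.
move=> m23 fm; have m0 : (0 < m)%N by case: m23 => [->|]; lia.
have fS r : antiperiodic m (fun k => f (k + r)%N) by exact: antiperiodic_comp_add.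
have f2 k : f (k + 2 * m)%N = f k by rewrite antiperiodicM.
have isones r : (forall k, (k < m)%N -> f (k + r)%N = false) ->
    exists r, forall k, f (k + r)%N = ones m k.
  move=> H; exists r; apply: (eq_antiperiodic m0) => //.
    exact: antiperiodic_ones.
  by move=> k km; rewrite H // /ones divn_small.
case: m23 => [m2|m3].
  (* With two settings all four sign vectors are translates of [ones]. *)
  left; have f2' k : f (k.+2)%N = ~~ f k by rewrite -fm m2 addn2.
  case F0 : (f 0%N); case F1 : (f 1%N).
  - by apply: (isones 2%N) => -[|[|k]]; rewrite m2 // => _; rewrite ?add0n ?add1n f2' ?F0 ?F1.
  - by apply: (isones 1%N) => -[|[|k]]; rewrite m2 // => _; rewrite ?add0n ?add1n ?f2' ?F0 ?F1.
  - by apply: (isones 3%N) => -[|[|k]]; rewrite m2 // => _; rewrite ?add0n ?add1n !f2' ?F0 ?F1.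
  - by apply: (isones 0%N) => -[|[|k]]; rewrite m2 // => _; rewrite addn0 ?F0 ?F1.
set y := hstep R m in s *.
have s0 : 0 < s := sin_hstep1_gt0 R m0.
pose Z r := expi y * fourier R m (fun k => f (k + r)%N) 1.
have ZS r : Z r = expi (2 * y) * Z r.+1.
  rewrite /Z (@fourier_shift R m _ 1 1) //.
  have -> : 2 * hstep R m * (1 * 1)%:R = 2 * y by rewrite mulr1.
  rewrite mulrCA; congr (_ * (_ * _)); apply: eq_fourier => k.
  by rewrite -addnA add1n.
have Zper r : Z (r + 2 * m)%N = Z r.
  by congr (_ * _); apply: eq_fourier => k; rewrite addnA f2.
have Zmod r : Z r = Z (r %% (2 * m))%N.
  rewrite {1}(divn_eq r (2 * m)); elim: (r %/ _)%N => [//|q IHq].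
  by rewrite mulSn -addnA addnC Zper.
have m2 : (0 < 2 * m)%N by lia.
(* A translation maximizing the imaginary part is compared with its two
   neighbours: this places the sum within [y] of the axis. *)
have [r Zmax] : exists r, forall i, complex.Im (Z i) <= complex.Im (Z r).
  have [i _ imax] := @arg_maxP _ _ _ (Ordinal m2) predT
    (fun i : 'I_(2 * m) => complex.Im (Z i)) isT.
  exists i => j; rewrite (Zmod j).
  by have := imax (Ordinal (ltn_pmod j m2)) isT.
set b := fun k => f (k + r)%N.
have Zre : complex.Re (Z r) = \sum_(k < m) (-1) ^+ b k * cos ((2 * k + 1)%:R * y).
  rewrite /Z /fourier big_distrr /= Re_sum; apply: eq_bigr => k _.
  rewrite mulrCA Re_signM -expiD /=; congr (_ * cos _).
  by rewrite mul1n natrD natrM /y; ring.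
have Zim : complex.Im (Z r) = \sum_(k < m) (-1) ^+ b k * sin ((2 * k + 1)%:R * y).
  rewrite /Z /fourier big_distrr /= Im_sum; apply: eq_bigr => k _.
  rewrite mulrCA Im_signM -expiD /=; congr (_ * sin _).
  by rewrite mul1n natrD natrM /y; ring.
have nZ : Normc.normc (fourier R m f 1) ^+ 2 = complex.Im (Z r) ^+ 2 + complex.Re (Z r) ^+ 2.
  rewrite [RHS]addrC -normc_sqr /Z Normc.normcM normc_expi mul1r.
  by rewrite (@fourier_shift R m f 1 r) // Normc.normcM normc_expi mul1r.
have HXY : `|complex.Re (Z r)| * cos y <= complex.Im (Z r) * s.
  have A := Zmax (r + 2 * m).-1; have B := Zmax r.+1.
  have EA : Z (r + 2 * m).-1 = expi (2 * y) * Z r.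
    by rewrite ZS prednK ?Zper //; lia.
  rewrite EA /expi {EA} in A.
  have EB : Z r.+1 = expi (- (2 * y)) * Z r.
    by rewrite (ZS r) mulrA -expiD addNr expi0 mul1r.
  rewrite EB /expi {EB} cosN sinN in B.
  move: A B; case: (Z r) => [Y X] /=.
  have -> : 2 * y = y *+ 2 by rewrite mulr_natl.
  rewrite sin_mulr2n cos_mulr2n cos2sin2 -/s !mulr2n => A B.
  rewrite -(ler_pM2l s0); case: (ger0P Y) => _; lra.
have := @window_bound R m b m3; rewrite -Zre -Zim => /(_ HXY) [[bint bend]|H]; last first.
  right; split=> //; rewrite -nZ in H.
  rewrite -ler_sqr ?nnegrE ?normc_ge0 //.
  by rewrite mulr_ge0 ?(gap_ge0 R m3) // invr_ge0 ltW.
left.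
have kend k : (k < m)%N -> [\/ k = 0%N, (0 < k < m.-1)%N | k = m.-1].
  clear -m3 => km; have [->|k0] := posnP k; first by constructor 1.
  by case: (ltnP k m.-1) => H; [constructor 2 | constructor 3; lia].
case b0 : (b 0%N) bend => /=; case bm : (b m.-1) => //= _.
(* A minus at the left end only: the window moves forward, and the dropped sign re-enters on the
   right as a plus. *)
- apply: (isones r.+1) => k km.
  have [kE|kE|kE] : [\/ k.+1 = m, (0 < k.+1 < m.-1)%N | k.+1 = m.-1].
    by clear -km; case: (ltngtP k.+1 m.-1) => H; [constructor 2|constructor 1|constructor 3]; lia.
  + by rewrite addnS -addSn kE addnC fm; move: b0; rewrite /b add0n => ->.
  + by rewrite addnS -addSn; exact: bint kE.
  + by rewrite addnS -addSn kE; exact: bm.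
(* A minus at the right end only: the window moves back by one, written modulo [2 * m] as [r] may be
   0. *)
- apply: (isones (r + 2 * m).-1) => -[|k] km.
    rewrite add0n; have -> : (r + 2 * m).-1 = (m.-1 + r + m)%N by clear -m3; lia.
    by rewrite fm; move: bm; rewrite /b => ->.
  have -> : (k.+1 + (r + 2 * m).-1 = k + r + 2 * m)%N by clear -m3; lia.
  rewrite f2; case: (kend k (ltnW km)) => [->|/bint//|E] //.
  by move: km; rewrite E; clear -m3; lia.
- apply: (isones r) => k /kend[->|/bint//|->] //.
Qed.

(* Up to a translation, [f] is the Galois conjugate of [ones] whose spectrum is
   maximal at the frequency [g]. *)
Definition peaked (R : realType) (m : nat) (f : nat -> bool) (g : nat) : Prop :=
  exists r, forall h, odd h ->
    fourier R m f (g * h) = expi (2 * hstep R m * (h * r)%:R) * fourier R m (ones m) h.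

Lemma odd_inv_pow2 x g : odd g -> exists2 h, odd h & (g * h = 1 %[mod 2 ^ x.+1])%N.
Proof.
move=> og; have g0 : (0 < g)%N by case: g og.
have : coprime g (2 ^ x.+1) by rewrite coprimeXr // coprimen2.
case/(coprimeP _ g0) => -[u v] /= uv.
have E : (u * g = 1 + v * 2 ^ x.+1)%N by lia.
exists u; last by rewrite mulnC E addnC modnMDl.
have : odd (u * g) by rewrite E oddD oddM oddX /= andbF.
by rewrite oddM => /andP[].
Qed.

(* A dilation of the indices by the inverse of [g] modulo [2 * m], available
   because [m] is a power of 2, moves the frequency [g] to 1. *)
Lemma peak_dichotomy (R : realType) x m f g (s := sin (hstep R m)) :
  m = (2 ^ x)%N -> (1 < m)%N -> antiperiodic m f -> odd g ->
  peaked R m f g \/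
  (3 < m)%N /\ Normc.normc (fourier R m f g) <= s^-1 * (1 - 4 * s ^+ 2).
Proof.
move=> mE m1 fm og; have m0 : (0 < m)%N by lia.
have [h oh gh] := odd_inv_pow2 x og; rewrite expnS -mE in gh.
have tm : antiperiodic m (fun k => f (h * k)%N).
  by move=> k; rewrite mulnDr antiperiodicM // oh.
have m23 : m = 2%N \/ (3 < m)%N.
  case: x mE => [|[|x]] mE; [by rewrite mE in m1 | by left | right].
  by rewrite mE (@leq_pexp2l 2 2).
case: (shift_dichotomy R m23 tm) => [[r Hr]|[m3 H]]; [left|right]; last first.
  by split=> //; move: H; rewrite (fourier_twist R m0 fm gh) ?muln1.
exists r => i oi; rewrite -(fourier_twist R m0 fm gh) //.
rewrite (fourier_shift R r m0 tm oi); congr (_ * _); exact: eq_fourier.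
Qed.

(** On the indices [l], multiplication by [g] is the affine map [g * l + g./2], of slope coprime to
    [m]. *)
Lemma sum_odd_multiple (V : zmodType) x m g (phi : nat -> V) :
  m = (2 ^ x)%N -> odd g -> (forall h h', h = h' %[mod 2 * m] -> phi h = phi h') ->
  \sum_(l < m) phi (g * (2 * l + 1))%N = \sum_(l < m) phi (2 * l + 1)%N.
Proof.
move=> mE og per.
rewrite -(@sum_periodic_affine V m g g./2 (fun l => phi (2 * l + 1)%N)).
- apply: eq_bigr => l _; congr phi.
  by move: (odd_double_half g); rewrite og -muln2; move: g./2 => h <- /=; lia.
- by rewrite mE; case: x mE => [|x] _; rewrite ?expn0 ?coprimen1 // coprimeXr // coprimen2.
- by move=> k; apply: per; rewrite mulnDr addnAC modnDr.
Qed.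

(** * Strategies with a common peak *)

(** The unnormalized value when all parties share a peak ([same_peak_sum]); the formula of the
    theorem is the case [P = 1]. *)
Definition peak_sum (R : realType) (m n P : nat) : R :=
  \sum_(l < m) (-1) ^+ l * (cos ((2 * l + 1)%:R * P%:R * hstep R m)
                            / sin ((2 * l + 1)%:R * hstep R m) ^+ n).

Lemma odd_2l1 l : odd (2 * l + 1).
Proof. by rewrite oddD oddM. Qed.

Lemma sin_odd_gt0 (R : realType) m l : (l < m)%N ->
  0 < sin ((2 * l + 1)%:R * hstep R m).
Proof. by move=> lm; apply: sin_hstep_gt0; lia. Qed.

Lemma fourier_ones_div (R : realType) m l : (l < m)%N ->
  fourier R m (ones m) (2 * l + 1) =
  expi (pi / 2 - (2 * l + 1)%:R * hstep R m)
    * ((sin ((2 * l + 1)%:R * hstep R m))^-1)%:C%C.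
Proof.
move=> lm; have m0 : (0 < m)%N by lia.
have s0 := sin_odd_gt0 R lm.
rewrite -fourier_ones ?odd_2l1 // -mulrA -rmorphM /= mulfV ?gt_eqF // mulr1 //.
Qed.

(** Each party contributes the spectrum of [ones] times a phase. The phases combine into [P], and
    since [n] is odd the leftover multiples of pi give the signs [(-1) ^+ l]. *)
Lemma same_peak_sum (R : realType) x m n (f : 'I_n -> nat -> bool) g (r : 'I_n -> nat) :
  m = (2 ^ x)%N -> (0 < m)%N -> odd n -> odd g ->
  (forall j h, odd h -> fourier R m (f j) (g * h) =
     expi (2 * hstep R m * (h * r j)%:R) * fourier R m (ones m) h) ->
  complex.Re (\sum_(l < m) \prod_(j < n) fourier R m (f j) (2 * l + 1))
    = peak_sum R m n (n * m.-1 + 2 * \sum_(j < n) r j).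
Proof.
move=> mE m0 on og Hr.
rewrite -(@sum_odd_multiple _ x m g (fun h => \prod_(j < n) fourier R m (f j) h)) //;
  last first.
  by move=> h h' E; apply: eq_bigr => j _; exact: fourier_mod.
rewrite Re_sum; apply: eq_bigr => l _; set h := (2 * l + 1)%N; set y := hstep R m.
have oh : odd h by exact: odd_2l1.
under eq_bigr do rewrite Hr //.
rewrite big_split /= -expi_sum prodr_const card_ord fourier_ones_div //.
rewrite -/h -/y; set S := \sum_(i < n) _; set b := (sin _)^-1.
pose t := S + n%:R * (pi / 2 - h%:R * y); pose v := b ^+ n.
have -> : expi S * (expi (pi / 2 - h%:R * y) * b%:C%C) ^+ n = expi t * v%:C%C.
  by rewrite /t /v exprMn (expiD S) expiX rmorphXn mulrA.
have -> : complex.Re (expi t * v%:C%C) = cos t * v by rewrite /= mulr0 subr0.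
set P := (n * _ + _)%N.
have PE : h%:R * P%:R * y = t + (l * n)%:R * pi.
  rewrite /t /S /P -mulr_sumr -natr_sum -big_distrr /= -(hstepM R m0) -/y.
  have -> : m.-1 = (m - 1)%N by rewrite subn1.
  by rewrite !(natrD, natrM) natrB // /h ?(natrD, natrM); field.
rewrite PE cosDpiMn -(signr_odd _ (l * n)) oddM on andbT signr_odd /v /b exprVn.
by rewrite !mulrA -expr2 sqrr_sign mul1r.
Qed.

Lemma cos_peak_eq (R : realType) m P h : (0 < m)%N ->
  (P %% (4 * m) = 1)%N \/ (P %% (4 * m) = 4 * m - 1)%N ->
  cos (h%:R * P%:R * hstep R m) = cos (h%:R * hstep R m).
Proof.
move=> m0 HP; set y := hstep R m.
have E : 4 * m%:R * y = 2 * pi by rewrite -(hstepM R m0) -/y; ring.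
have [q [->|PE]] : exists q, P = (1 + q * (4 * m))%N \/ (P + 1 = q * (4 * m))%N.
  case: HP => HP; [exists (P %/ (4 * m))%N; left | exists (P %/ (4 * m)).+1; right].
    by rewrite {1}(divn_eq P (4 * m)) HP addnC.
  by rewrite {1}(divn_eq P (4 * m)) HP mulSn; lia.
  rewrite -(cosD2piMn (h%:R * y) (h * q)) -E; congr cos.
  by rewrite natrD !natrM; ring.
rewrite -[RHS]cosN -(cosD2piMn (- (h%:R * y)) (h * q)) -E; congr cos.
have : (P + 1)%:R = (q * (4 * m))%:R :> R by rewrite PE.
rewrite natrD !natrM => E'; have -> : P%:R = q%:R * (4 * m%:R) - 1 :> R by rewrite -E' addrK.
ring.
Qed.

(** Modulo 2 pi the odd multiples of y nearest to 0 are y and -y, then 3 y and -3 y. *)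
Lemma cos_peak_le (R : realType) m P : (1 < m)%N -> odd P ->
  (P %% (4 * m) = 1)%N \/ (P %% (4 * m) = 4 * m - 1)%N \/
  cos (P%:R * hstep R m) <= cos (3 * hstep R m).
Proof.
move=> m1 oP; have m0 : (0 < m)%N by lia.
set y := hstep R m; have y0 : 0 < y := hstep_gt0 R m0.
have E : 4 * m%:R * y = 2 * pi by rewrite -(hstepM R m0) -/y; ring.
set p := (P %% (4 * m))%N.
have op : odd p.
  move: oP; rewrite (divn_eq P (4 * m)) oddD !oddM /= andbF //.
have pm : (p < 4 * m)%N by rewrite ltn_mod; lia.
have cosp : cos (P%:R * y) = cos (p%:R * y).
  rewrite -(cosD2piMn (p%:R * y) (P %/ (4 * m))) -E {1}(divn_eq P (4 * m)) -/p.
  by rewrite natrD !natrM; congr cos; ring.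
have ineq k : (3 <= k <= 2 * m)%N -> cos (k%:R * y) <= cos (3 * y).
  move=> /andP[k3 km].
  have piE : pi = (2 * m)%:R * y by rewrite -(hstepM R m0) natrM -/y; ring.
  have ky : k%:R * y \in `[0, pi].
    by rewrite in_itv /= mulr_ge0 ?(ltW y0) // piE ler_pM2r // ler_nat.
  have y3 : 3 * y \in `[0, pi].
    rewrite in_itv /= mulr_ge0 ?(ltW y0) // piE ler_pM2r // ler_nat.
    exact: leq_trans km.
  by rewrite leNgt ltr_cos // -leNgt ler_pM2r // ler_nat.
rewrite cosp.
have p0 : p != 0%N by case: p op {pm cosp}.
have p2 : p != 2%N by apply: contraL op => /eqP->.
have p4 : p != (4 * m - 2)%N.
  by apply: contraL op => /eqP->; rewrite oddB ?oddM //; lia.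
case: (ltnP p (2 * m).+1) => pm'.
  case: (ltngtP p 1) => [p1|p1|->]; [by exfalso; lia | | by left].
  by right; right; apply: ineq; lia.
case: (ltngtP p (4 * m - 1)) => [p1|p1|->]; [ | by exfalso; lia | by right; left].
right; right; have := ineq (4 * m - p)%N.
rewrite natrB; last by lia.
rewrite mulrBl natrM E -cosN opprB -(cosD2piMn _ 1) mul1r subrK; apply; lia.
Qed.

(** The terms [l] and [m - l.+1] agree: the cosine and, [m] being even, the alternating sign both
    change sign. *)
Lemma half_sum (R : realType) m n : (2 %| m)%N -> (0 < m)%N ->
  peak_sum R m n 1 = 2 * \sum_(j < (m %/ 2)%N)
     (-1) ^+ j * (cos ((2 * j%:R + 1) * pi / (2 * m%:R))
                  / sin ((2 * j%:R + 1) * pi / (2 * m%:R)) ^+ n).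
Proof.
move=> /dvdnP[k mE] m0; rewrite mE mulnK // -mE.
set F := fun j : nat => (-1) ^+ j * (cos ((2 * j%:R + 1) * pi / (2 * m%:R))
                  / sin ((2 * j%:R + 1) * pi / (2 * m%:R)) ^+ n) : R.
have FE (l : nat) : (-1) ^+ l * (cos ((2 * l + 1)%:R * 1%:R * hstep R m)
   / sin ((2 * l + 1)%:R * hstep R m) ^+ n) = F l.
  by rewrite /F mulr1 natrD natrM /hstep !mulrA.
rewrite /peak_sum; under eq_bigr do rewrite FE.
have Fsym l : (l < m)%N -> F (m - l.+1)%N = F l.
  move=> lm; rewrite -!FE !mulr1.
  have -> : (2 * (m - l.+1) + 1 = 2 * m - (2 * l + 1))%N by lia.
  rewrite sin_hstepC //; last by lia.
  rewrite natrB; last by lia.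
  have -> : ((2 * m)%:R - (2 * l + 1)%:R) * hstep R m =
            - ((2 * l + 1)%:R * hstep R m) + pi.
    by rewrite -(hstepM R m0) natrM; ring.
  rewrite cosDpi cosN mulNr mulrN -mulNr; congr (_ * _).
  rewrite -(signr_odd _ (m - _)) -(signr_odd _ l) oddB // mE oddM andbF /=.
  by case: (odd l); rewrite ?expr0 ?expr1 ?opprK.
have {mE}mE : m = (k + k)%N by rewrite mE; lia.
transitivity (\sum_(l < k + k) F l); first by rewrite mE.
rewrite big_split_ord /= [X in _ + X](reindex_inj rev_ord_inj) /=.
rewrite [X in _ + X](_ : _ = \sum_(i < k) F i).
  by rewrite -mulr2n mulr_natl.
apply: eq_bigr => i _; rewrite -Fsym; last by rewrite mE; have := ltn_ord i; lia.
by congr F; rewrite mE; have := ltn_ord i; lia.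
Qed.

(** * Power sums of amplitudes *)

(* Normalized so that its maximal value, reached by [ones] at [h = 1], is 1. *)
Definition amplitude (R : realType) (m : nat) (f : nat -> bool) (h : nat) : R :=
  sin (hstep R m) * Normc.normc (fourier R m f h).

Definition ratio (R : realType) (m l : nat) : R :=
  sin (hstep R m) / sin ((2 * l + 1)%:R * hstep R m).

(** The indices 0 and [m.-1] are the frequencies 1 and -1 modulo [2 * m], where [ratio] is 1; the
    tail gathers the others. *)
Definition tail (R : realType) (m N : nat) : R :=
  \sum_(l < m | (0 < l < m.-1)%N) ratio R m l ^+ N.

Lemma amplitude_ge0 (R : realType) m f h : (0 < m)%N -> 0 <= amplitude R m f h.
Proof. by move=> m0; rewrite mulr_ge0 ?normc_ge0 ?(ltW (sin_hstep1_gt0 R m0)). Qed.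

Lemma amplitude_mod (R : realType) m f h h' : (0 < m)%N ->
  h = h' %[mod 2 * m] -> amplitude R m f h = amplitude R m f h'.
Proof. by move=> m0 E; rewrite /amplitude (fourier_mod R f m0 E). Qed.

Lemma amplitude_ones (R : realType) m l : (l < m)%N ->
  amplitude R m (ones m) (2 * l + 1) = ratio R m l.
Proof.
move=> lm; have s0 := sin_odd_gt0 R lm.
by rewrite /amplitude fourier_ones_div // Normc.normcM normc_expi mul1r /=
  expr0n addr0 sqrtr_sqr gtr0_norm // invr_gt0.
Qed.

Lemma ratio_ge0 (R : realType) m l : (l < m)%N -> 0 <= ratio R m l.
Proof.
move=> lm; rewrite divr_ge0 ?(ltW (sin_odd_gt0 R lm)) //.
by rewrite ltW // sin_hstep1_gt0 //; lia.
Qed.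

Lemma ratio_end (R : realType) m l : (l < m)%N -> ~~ (0 < l < m.-1)%N ->
  ratio R m l = 1.
Proof.
move=> lm lend; have s0 : 0 < sin (hstep R m) by rewrite sin_hstep1_gt0 //; lia.
have [->|->] : l = 0%N \/ l = m.-1 by lia.
  by rewrite /ratio mul1r divff ?gt_eqF.
rewrite /ratio; have -> : (2 * m.-1 + 1 = 2 * m - 1)%N by lia.
rewrite sin_hstepC; [ | lia | lia].
by rewrite mul1r divff ?gt_eqF.
Qed.

Lemma sum_ratio (R : realType) m N : (1 < m)%N ->
  \sum_(l < m) ratio R m l ^+ N = 2 + tail R m N.
Proof.
move=> m1; have m0 : (0 < m)%N by lia.
have m1m : (m.-1 < m)%N by lia.
rewrite (bigD1 (Ordinal m0)) //= (bigD1 (Ordinal m1m)) /=; last first.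
  by rewrite -val_eqE /=; lia.
rewrite !ratio_end ?expr1n //=; try lia.
rewrite addrA; congr (1 + 1 + _); apply: eq_bigl => l.
by rewrite -!val_eqE /=; have := ltn_ord l; lia.
Qed.

(** Parseval's identity for [ones]. *)
Lemma tail2E (R : realType) m : (1 < m)%N ->
  2 + tail R m 2 = (m%:R * sin (hstep R m)) ^+ 2.
Proof.
move=> m1; have m0 : (0 < m)%N by lia.
rewrite -sum_ratio // exprMn mulrC -(parseval R (ones m) m0) mulr_sumr.
by apply: eq_bigr => l _; rewrite -amplitude_ones // -exprMn.
Qed.

(** The double-angle formula at pi / 8. The two facts determine the value sqrt 2 - 1 in polynomial
    form. *)
Lemma tan_pi8 (R : realType) (t := tan (pi / 8) : R) :
  0 < t /\ t ^+ 2 + 2 * t = 1.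
Proof.
have p0 := pi_gt0 R.
have c0 : 0 < cos (pi / 8 : R) by rewrite cos_gt0_pihalf //; apply/andP; split; lra.
have s0 : 0 < sin (pi / 8 : R) by rewrite sin_gt0_pihalf //; apply/andP; split; lra.
have t0 : 0 < t by rewrite divr_gt0.
split=> //; have := @tan_mulr2n R (pi / 8) (lt0r_neq0 c0).
have -> : pi / 8 *+ 2 = pi / 4 :> R by rewrite mulr2n; field.
rewrite tan_piquarter -/t => E.
have nz : 1 - t ^+ 2 != 0.
  by apply/eqP => H; move: E; rewrite H invr0 mulr0 => /eqP; rewrite oner_eq0.
have : 1 * (1 - t ^+ 2) = t *+ 2 by rewrite {1}E divfK.
by rewrite mulr2n; lra.
Qed.

Lemma mulr_tan_le (R : realType) (z : R) : 0 < z < pi / 4 ->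
  2 * tan z <= tan (2 * z).
Proof.
move=> /andP[z0 zp]; have p0 := pi_gt0 R.
have c0 : 0 < cos z by rewrite cos_gt0_pihalf //; apply/andP; split; lra.
have s0 : 0 < sin z by rewrite sin_gt0_pihalf //; apply/andP; split; lra.
have c2 : 0 < cos (2 * z) by rewrite cos_gt0_pihalf //; apply/andP; split; lra.
have s2 : 0 < sin (2 * z) by rewrite sin_gt0_pihalf //; apply/andP; split; lra.
have t0 : 0 < tan z by rewrite divr_gt0.
have : 0 < tan (2 * z) by rewrite divr_gt0.
rewrite mulr_natl tan_mulr2n ?gt_eqF // -mulr_natl.
have p2 : 0 < 2 * tan z by rewrite mulr_gt0.
rewrite pmulr_rgt0 // invr_gt0 => d0.
by rewrite ler_pdivlMr // ger_pMr // gerBl sqr_ge0.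
Qed.

(** By [mulr_tan_le], m tan (pi / (2 m)) does not increase when m doubles; at m = 4 it is 4 tan (pi
    / 8), and the sine is below the tangent. *)
Lemma pow2_sin_le (R : realType) x :
  (2 ^ x.+2)%:R * sin (hstep R (2 ^ x.+2)) <= 4 * tan (pi / 8).
Proof.
have p0 := pi_gt0 R.
have nz k : (2 ^ k)%:R != 0 :> R by rewrite pnatr_eq0 expn_eq0.
have hS k : hstep R (2 ^ k) = 2 * hstep R (2 ^ k.+1).
  by rewrite /hstep expnS natrM; field; exact: nz.
have y0 k : 0 < hstep R (2 ^ k) by rewrite hstep_gt0 // expn_gt0.
have le8 k : hstep R (2 ^ k.+2) <= pi / 8.
  elim: k => [|k IHk]; first by rewrite /hstep -natrM; lra.
  by rewrite hS in IHk; have := y0 k.+3; lra.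
have H : (2 ^ x.+2)%:R * tan (hstep R (2 ^ x.+2)) <= 4 * tan (pi / 8).
  elim: x => [|x IHx]; first by rewrite /hstep -natrM.
  apply: le_trans IHx; rewrite (hS x.+2).
  have -> : (2 ^ x.+3)%:R = 2 * (2 ^ x.+2)%:R :> R by rewrite expnS natrM.
  rewrite -mulrA mulrCA ler_wpM2l //.
  by apply: mulr_tan_le; rewrite y0 /=; have := le8 x; rewrite hS; have := y0 x.+3; lra.
apply: le_trans H; rewrite ler_wpM2l // /tan.
set y := hstep _ _.
have y8 : y <= pi / 8 := le8 x; have y1 : 0 < y := y0 x.+2.
have c0 : 0 < cos y by rewrite cos_gt0_pihalf //; apply/andP; split; lra.
have s0 : 0 < sin y by rewrite sin_gt0_pihalf //; apply/andP; split; lra.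
by rewrite ler_pdivlMr // ger_pMr // cos_le1.
Qed.

Lemma tail2_le (R : realType) x m : m = (2 ^ x)%N -> (1 < m)%N ->
  0 <= tail R m 2 <= 4 / 5.
Proof.
move=> mE m1; apply/andP; split.
  by apply: sumr_ge0 => l _; rewrite sqr_ge0.
case: x mE => [|[|x]] mE; first by rewrite mE in m1.
  rewrite /tail big1; first by rewrite divr_ge0.
  by rewrite expn1 in mE; move=> l lint; exfalso; lia.
have := tail2E R m1.
have := pow2_sin_le R x; rewrite -mE.
have [] := tan_pi8 R; set t := tan _; set k := m%:R * _ => t0 tE kt.
have k0 : 0 <= k by rewrite mulr_ge0 // ltW // sin_hstep1_gt0 //; lia.
(* A convergent of sqrt 2 - 1 from below: it gives 16 t^2 = 16 (1 - 2 t) <= 80 / 29 < 2 + 4 / 5. *)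
have t_ge : 12 / 29 <= t by nra.
have : k ^+ 2 <= (4 * t) ^+ 2 by rewrite ler_pXn2r ?nnegrE // mulr_ge0 ?ltW.
by rewrite exprMn; lra.
Qed.

(** The largest interior ratio is sin y / sin (3 y) = 1 / (1 + 2 cos (2 y)), and cos (2 y) >= 1 /
    sqrt 2 bounds it by 1 / (1 + sqrt 2). *)
Lemma ratio_le (R : realType) m l : (3 < m)%N -> (0 < l < m.-1)%N ->
  ratio R m l <= tan (pi / 8).
Proof.
move=> m3 lm; have lm' : (l < m)%N by lia.
have s0 : 0 < sin (hstep R m) by rewrite sin_hstep1_gt0 //; lia.
have sl := sin_odd_gt0 R lm'.
have H : sin (3%:R * hstep R m) <= sin ((2 * l + 1)%:R * hstep R m).
  by apply: sin_hstep_le; lia.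
have [t0 tE] := tan_pi8 R; have [c0 cE] := cos_2hstep_ge R m3.
rewrite /ratio ler_pdivrMr //.
apply: le_trans (_ : tan (pi / 8) * sin (3%:R * hstep R m) <= _); last first.
  by rewrite ler_wpM2l // ltW.
rewrite sin3x mulrCA ler_peMr ?(ltW s0) //.
move: c0 cE; set s2 := sin _ ^+ 2; set t := tan _ in t0 tE * => c0 cE.
have : t + 1 <= 2 * (1 - 2 * s2).
  by rewrite -ler_sqr ?nnegrE; nra.
nra.
Qed.

Lemma tail_le (R : realType) x m N : m = (2 ^ x)%N -> (1 < m)%N ->
  0 <= tail R m N.+2 <= tan (pi / 8) ^+ N * tail R m 2.
Proof.
move=> mE m1; apply/andP; split.
  by apply: sumr_ge0 => l _; rewrite exprn_ge0 // ratio_ge0.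
rewrite /tail mulr_sumr; apply: ler_sum => l lint.
have m3 : (3 < m)%N.
  case: x mE => [|[|x]] mE; [by rewrite mE in m1 | by rewrite expn1 in mE; lia |].
  by rewrite mE (@leq_pexp2l 2 2).
rewrite -(addn2 N) exprD ler_wpM2r ?sqr_ge0 //.
by rewrite lerXn2r ?nnegrE ?ratio_ge0 ?(ltW (tan_pi8 R).1) ?ratio_le.
Qed.

(** AM-GM for the powers [u i ^+ #|A|]. *)
Lemma prod_le_sum (R : realType) (I : finType) (A : {pred I}) (u : I -> R) :
  (forall i, 0 <= u i) -> (0 < #|A|)%N ->
  #|A|%:R * \prod_(i in A) u i <= \sum_(i in A) u i ^+ #|A|.
Proof.
move=> u0 A0; set N := #|A|.
have N0 : 0 < N%:R :> R by rewrite ltr0n.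
have [H _] := @leif_AGM R I A (fun i => u i ^+ N) (fun i _ => exprn_ge0 N (u0 i)).
move: H; rewrite -/N prodrXl ler_pXn2r //; last first.
- by rewrite nnegrE divr_ge0 // sumr_ge0 // => i _; rewrite exprn_ge0.
- by rewrite nnegrE prodr_ge0.
by rewrite ler_pdivlMr // mulrC.
Qed.

(** By the Galois action the amplitudes of [f] are those of [ones] in another order. *)
Lemma peaked_sum (R : realType) x m f g N : m = (2 ^ x)%N -> (1 < m)%N ->
  odd g -> peaked R m f g ->
  \sum_(l < m) amplitude R m f (2 * l + 1) ^+ N = 2 + tail R m N.
Proof.
move=> mE m1 og [r Hr]; have m0 : (0 < m)%N by lia.
rewrite -(@sum_odd_multiple _ x m g (fun h => amplitude R m f h ^+ N)) //; last first.
  by move=> h h' E; rewrite (amplitude_mod R f m0 E).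
rewrite -sum_ratio //; apply: eq_bigr => l _; congr (_ ^+ _).
rewrite -amplitude_ones // /amplitude Hr ?odd_2l1 //.
by rewrite Normc.normcM normc_expi mul1r.
Qed.

Lemma not_peaked_le (R : realType) x m f h : m = (2 ^ x)%N -> (1 < m)%N ->
  antiperiodic m f -> odd h -> ~ peaked R m f h ->
  (3 < m)%N /\ amplitude R m f h <= 1 - 4 * sin (hstep R m) ^+ 2.
Proof.
move=> mE m1 fm oh np; have m0 : (0 < m)%N by lia.
have s0 := sin_hstep1_gt0 R m0.
have [//|[m3 H]] := peak_dichotomy R mE m1 fm oh; split=> //.
by move: H; rewrite -(ler_pM2l s0) mulrA mulfV ?gt_eqF // mul1r.
Qed.

(** The amplitude is the [ratio] at the frequency h / g modulo [2 * m]; an end index would give 1,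
    which the gap for a vector not peaked at [h] forbids. *)
Lemma off_peak_le (R : realType) x m f g h : m = (2 ^ x)%N -> (1 < m)%N ->
  antiperiodic m f -> odd g -> odd h -> peaked R m f g -> ~ peaked R m f h ->
  amplitude R m f h <= tan (pi / 8).
Proof.
move=> mE m1 fm og oh [r Hr] np; have m0 : (0 < m)%N by lia.
have [m3 le_q] := not_peaked_le mE m1 fm oh np.
have [g' og' gg'] := odd_inv_pow2 x og; rewrite expnS -mE in gg'.
pose i := ((g' * h) %% (2 * m))%N.
have oi : odd i.
  have : odd (g' * h) by rewrite oddM og' oh.
  by rewrite (divn_eq (g' * h) (2 * m)) -/i oddD !oddM /= andbF.
have im : (i < 2 * m)%N by rewrite ltn_mod; lia.
have iE : i = (2 * i./2 + 1)%N by rewrite -[LHS]odd_double_half oi; lia.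
have lm : (i./2 < m)%N by lia.
have hE : amplitude R m f h = ratio R m i./2.
  rewrite -amplitude_ones // -iE (@amplitude_mod _ _ _ h (g * i)) //; last first.
    by rewrite /i modnMmr mulnA -[in RHS]modnMml gg' modnMml mul1n.
  by rewrite /amplitude Hr // Normc.normcM normc_expi mul1r.
rewrite hE; case: (boolP (0 < i./2 < m.-1)%N) => lint; first exact: ratio_le.
move: le_q; rewrite hE ratio_end // => le_q; exfalso.
have := sin_hstep1_gt0 R m0; nra.
Qed.

(** The gap bounds [N] of the [N.+2] factors; Parseval's identity sums the remaining squares. *)
Lemma not_peaked_sum (R : realType) x m f N : m = (2 ^ x)%N -> (1 < m)%N ->
  antiperiodic m f -> (forall g, odd g -> ~ peaked R m f g) ->
  \sum_(l < m) amplitude R m f (2 * l + 1) ^+ N.+2 <=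
  (1 - 4 * sin (hstep R m) ^+ 2) ^+ N * (m%:R * sin (hstep R m)) ^+ 2.
Proof.
move=> mE m1 fm np; have m0 : (0 < m)%N by lia.
rewrite exprMn [_ ^+ 2 * _]mulrC -(parseval R f m0) !mulr_sumr; apply: ler_sum => l _.
rewrite -exprMn -/(amplitude R m f _) -(addn2 N) exprD ler_wpM2r ?sqr_ge0 //.
have [m3 H] := not_peaked_le mE m1 fm (odd_2l1 l) (np _ (odd_2l1 l)).
by rewrite lerXn2r ?nnegrE ?amplitude_ge0 ?gap_ge0.
Qed.

(** * The thresholds *)

Lemma cos3x (R : realType) (y : R) : cos (3 * y) = 4 * cos y ^+ 3 - 3 * cos y.
Proof.
have -> : 3 * y = y *+ 2 + y by rewrite mulr2n; ring.
rewrite cosD sin_mulr2n cos_mulr2n !mulr2n.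
transitivity ((2 * cos y ^+ 2 - 1) * cos y - 2 * cos y * sin y ^+ 2); first by ring.
by rewrite sin2cos2; ring.
Qed.

Lemma ratioX (R : realType) m n l (z : R) :
  sin (hstep R m) ^+ n * (z / sin ((2 * l + 1)%:R * hstep R m) ^+ n) =
  z * ratio R m l ^+ n.
Proof. by rewrite /ratio expr_div_n mulrCA. Qed.

(** After normalization the frequencies 1 and -1 contribute cos (P y) each, and any other at most
    its power of [ratio], cosines being bounded by 1. *)
Lemma peak_sum_near (R : realType) m n P : (1 < m)%N -> ~~ odd m -> odd P ->
  `|sin (hstep R m) ^+ n * peak_sum R m n P - 2 * cos (P%:R * hstep R m)|
    <= tail R m n.
Proof.
move=> m1 em oP; have m0 : (0 < m)%N by lia.
have m1m : (m.-1 < m)%N by lia.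
set y := hstep R m; pose phi l := (-1) ^+ l * cos ((2 * l + 1)%:R * P%:R * y) * ratio R m l ^+ n.
have -> : sin y ^+ n * peak_sum R m n P = \sum_(l < m) phi l.
  rewrite /peak_sum mulr_sumr; apply: eq_bigr => l _.
  by rewrite mulrCA ratioX mulrA.
have phi0 : phi 0%N = cos (P%:R * y).
  by rewrite /phi ratio_end ?expr1n // expr0 mul1r mulr1 mul1r.
(* The sign is -1 because [m] is even, and the cosine changes sign as well because [P] is odd. *)
have phim : phi m.-1 = cos (P%:R * y).
  rewrite /phi ratio_end ?expr1n //; last by lia.
  rewrite mulr1 -signr_odd; have -> : odd m.-1 by lia.
  have -> : (2 * m.-1 + 1 = 2 * m - 1)%N by lia.
  rewrite natrB; last by lia.
  have -> : ((2 * m)%:R - 1%:R) * P%:R * y = - (P%:R * y) + P%:R * pi.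
    by rewrite -(hstepM R m0) -/y natrM; ring.
  by rewrite cosDpiMn -(signr_odd _ P) oP cosN expr1 !mulN1r opprK.
rewrite (bigD1 (Ordinal m0)) //= (bigD1 (Ordinal m1m)) /=; last first.
  by rewrite -val_eqE /=; lia.
rewrite phi0 phim; set S := \sum_(i < m | _) _.
have -> : cos (P%:R * y) + (cos (P%:R * y) + S) - 2 * cos (P%:R * y) = S by ring.
apply: le_trans (ler_norm_sum _ _ _) _.
rewrite /tail [leRHS](eq_bigl (fun l : 'I_m => (l != Ordinal m0) && (l != Ordinal m1m))).
  apply: ler_sum => l _; rewrite /phi !normrM normr_sign mul1r normrX.
  by rewrite (ger0_norm (ratio_ge0 R _)) // ler_piMl ?exprn_ge0 ?ratio_ge0 // cos_max.
by move=> l; rewrite -!val_eqE /=; have := ltn_ord l; lia.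
Qed.

(** The threshold without logarithms; [ln (tan (pi / 8))] is negative, so clearing it reverses the
    inequality. *)
Lemma n_odd2_le (R : realType) m n (t := tan (pi / 8) : R) (c := cos (hstep R m)) :
  (1 < m)%N -> n_odd2 R m <= n%:Z -> t ^+ n * (1 + 5 / 4 * c) <= 1 - c.
Proof.
move=> m1; rewrite ceil_le_int -/(hstep R m) -/c -/t => H.
have m0 : (0 < m)%N by lia.
have c0 : 0 < c := cos_hstep1_gt0 R m1.
have s0 : 0 < sin (hstep R m) := sin_hstep1_gt0 R m0.
have c1 : 0 < 1 - c by have := cos2Dsin2 (hstep R m); rewrite -/c; nra.
have [] := tan_pi8 R; rewrite -/t => t0 tE; clearbody t.
have t1 : ln t < 0 by rewrite ln_lt0 // t0 /=; nra.
have B0 : 0 < 1 + 5 / 4 * c by lra.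
rewrite -ler_pdivlMr // -ler_ln ?posrE ?exprn_gt0 ?divr_gt0 //.
rewrite lnXn // (@ln_div R (1 - c) (1 + 5 / 4 * c)) ?posrE //.
by move: H; rewrite ler_ndivrMr // -[ln t *+ n]mulr_natl.
Qed.

Lemma cos_hstep_ge2 (R : realType) m (c := cos (hstep R m)) :
  (1 < m)%N -> 7 / 10 <= c.
Proof.
move=> m1; have m0 : (0 < m)%N by lia.
have c0 : 0 < c := cos_hstep1_gt0 R m1.
have s0 : 0 < sin (hstep R m) := sin_hstep1_gt0 R m0.
have cE : c = sin ((m - 1)%:R * hstep R m).
  rewrite natrB //.
  have -> : (m%:R - 1) * hstep R m = - (hstep R m - pi / 2).
    by rewrite -(hstepM R m0); field.
  by rewrite sinN sinBpihalf opprK.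
have : sin (hstep R m) <= c by rewrite cE; apply: sin_hstep1_le; lia.
have := cos2Dsin2 (hstep R m); rewrite -/c; nra.
Qed.

(** From cos (2 y) >= 1 / sqrt 2 >= 7 / 10, the square of [c] is at least 85 / 100. *)
Lemma cos_hstep_ge4 (R : realType) m (c := cos (hstep R m)) :
  (3 < m)%N -> 92 / 100 <= c.
Proof.
move=> m3; have m1 : (1 < m)%N by lia.
have c0 : 0 < c := cos_hstep1_gt0 R m1.
have [C0 C1] := cos_2hstep_ge R m3.
have := cos2Dsin2 (hstep R m); rewrite -/c => E.
move: C0 C1; have -> : 1 - 2 * sin (hstep R m) ^+ 2 = 2 * c ^+ 2 - 1 by lra.
move=> C0 C1; have C2 : 7 / 10 <= 2 * c ^+ 2 - 1 by nra.
nra.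
Qed.

(** Brings the bound of [not_peaked_sum] for exponent [n.-1] below 2, the contribution of two full
    peaks. As m >= 4, the base [1 - 4 * s ^+ 2] lies strictly between 0 and 1 and its logarithm is
    negative. *)
Lemma n_even_le (R : realType) m n (s := sin (hstep R m)) :
  (3 < m)%N -> n_even R m + 1 <= n%:Z -> (3 <= n)%N ->
  (1 - 4 * s ^+ 2) ^+ (n - 3) * (m%:R * s) ^+ 2 <= 2.
Proof.
move=> m3; rewrite -lerBrDr ceil_le_int -/(hstep R m) -/s => H n3.
have m0 : (0 < m)%N by lia.
have s0 : 0 < s := sin_hstep1_gt0 R m0.
have c92 := cos_hstep_ge4 R m3.
have q0 : 0 < 1 - 4 * s ^+ 2.
  by have := cos2Dsin2 (hstep R m); rewrite -/s; nra.
have q1 : ln (1 - 4 * s ^+ 2) < 0 by rewrite ln_lt0 // q0 /=; nra.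
have ms0 : 0 < m%:R * s by rewrite mulr_gt0 ?ltr0n.
rewrite -ler_pdivlMr ?exprn_gt0 // -ler_ln ?posrE ?exprn_gt0 ?divr_gt0 ?exprn_gt0 //.
rewrite lnXn // ln_div ?posrE ?exprn_gt0 // lnXn //.
have l2 : ln 2 = ln (Num.sqrt 2) *+ 2 :> R.
  by rewrite -lnXn ?sqr_sqrtr // sqrtr_gt0.
rewrite l2 -mulrnBl -[ln (1 - _) *+ _]mulr_natr natrB // mulr2n.
move: H; set L := ln (Num.sqrt 2) - _; set Q := ln (1 - _) in q1 *.
rewrite intrB => H.
have H' : L / Q <= (n%:R - 3) / 2 by lra.
by move: H'; rewrite ler_ndivrMr //; lra.
Qed.

(** * Upper bound and attainment *)

(** Powers of [t] decrease, so it is enough to refute n = 2, and n = 3 when m >= 4, with the lower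
    bounds on [c]. *)
Lemma n_ge (R : realType) m n (t := tan (pi / 8) : R) (c := cos (hstep R m)) :
  (1 < m)%N -> t ^+ n * (1 + 5 / 4 * c) <= 1 - c ->
  (3 <= n)%N /\ ((3 < m)%N -> (4 <= n)%N).
Proof.
move=> m1 H; have [] := tan_pi8 R; rewrite -/t => t0 tE; clearbody t.
have c7 : 7 / 10 <= c := cos_hstep_ge2 R m1.
have t_ge : 12 / 29 <= t by nra.
have t_le : t <= 1 / 2 by nra.
have t1 : t <= 1 by lra.
have pw k : (n <= k)%N -> t ^+ k <= t ^+ n.
  by move=> nk; rewrite ler_wiXn2l // ltW.
split=> [|m3]; rewrite ltnNge; apply/negP => /pw Hk.
  by have : t ^+ 2 <= 3 / 10 / (15 / 8); nra.
have c9 : 92 / 100 <= c := cos_hstep_ge4 R m3.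
have : t ^+ 3 * (2 + 15 / 100) <= 8 / 100.
  have B0 : 2 + 15 / 100 <= 1 + 5 / 4 * c by lra.
  have : t ^+ 3 * (2 + 15 / 100) <= t ^+ n * (1 + 5 / 4 * c).
    by rewrite ler_pM // exprn_ge0 // ltW.
  lra.
by have -> : t ^+ 3 = t * t ^+ 2 by []; nra.
Qed.

Lemma Re_prod_le (R : realType) m n (f : 'I_n -> nat -> bool) : (0 < m)%N ->
  sin (hstep R m) ^+ n *
    complex.Re (\sum_(l < m) \prod_(j < n) fourier R m (f j) (2 * l + 1))
  <= \sum_(l < m) \prod_(j < n) amplitude R m (f j) (2 * l + 1).
Proof.
move=> m0; rewrite Re_sum mulr_sumr; apply: ler_sum => l _.
rewrite big_split /= prodr_const card_ord ler_wpM2l //.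
  by rewrite exprn_ge0 // ltW // sin_hstep1_gt0.
by rewrite -normc_prod Re_le_normc.
Qed.

(** The omitted party [k l] varies with the frequency, so after AM-GM the sum is enlarged to all [n]
    parties, at the cost of a factor [n / n.-1]. *)
Lemma sum_prod_others_le (R : realType) m n (f : 'I_n -> nat -> bool) (k : 'I_m -> 'I_n) B :
  (1 < n)%N -> (0 < m)%N ->
  (forall j, \sum_(l < m) amplitude R m (f j) (2 * l + 1) ^+ n.-1 <= B) ->
  n.-1%:R * \sum_(l < m) \prod_(j < n | j != k l) amplitude R m (f j) (2 * l + 1)
    <= n%:R * B.
Proof.
move=> n1 m0 HB; rewrite mulr_sumr.
have card l : #|[pred j | j != k l]| = n.-1.
  have := cardC1 (k l); rewrite card_ord => <-; exact: eq_card.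
apply: (@le_trans _ _ (\sum_(l < m) \sum_(j < n) amplitude R m (f j) (2 * l + 1) ^+ n.-1)).
  apply: ler_sum => l _.
  have := @prod_le_sum R _ [pred j | j != k l] (fun j => amplitude R m (f j) (2 * l + 1))
    (fun j => amplitude_ge0 R (f j) _ m0).
  rewrite card => /(_ _)/le_trans; apply; first by lia.
  rewrite [leRHS](bigID [pred j | j != k l]) /= lerDl sumr_ge0 // => j _.
  by rewrite exprn_ge0 // amplitude_ge0.
rewrite exchange_big /= mulr_natl -[n in B *+ n]card_ord -sumr_const.
exact: ler_sum.
Qed.

(** With the same party omitted everywhere, AM-GM averages exactly [n.-1] power sums and no factor
    is lost. *)
Lemma sum_prod_fixed_le (R : realType) m n (f : 'I_n -> nat -> bool) (k : 'I_n) B :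
  (1 < n)%N -> (0 < m)%N ->
  (forall j, \sum_(l < m) amplitude R m (f j) (2 * l + 1) ^+ n.-1 <= B) ->
  \sum_(l < m) \prod_(j < n | j != k) amplitude R m (f j) (2 * l + 1) <= B.
Proof.
move=> n1 m0 HB; have n0 : 0 < n.-1%:R :> R by rewrite ltr0n; lia.
have card : #|[pred j | j != k]| = n.-1.
  have := cardC1 k; rewrite card_ord => <-; exact: eq_card.
rewrite -(ler_pM2l n0) mulr_sumr.
apply: (@le_trans _ _ (\sum_(l < m) \sum_(j < n | j != k) amplitude R m (f j) (2 * l + 1) ^+ n.-1)).
  apply: ler_sum => l _.
  have := @prod_le_sum R _ [pred j | j != k] (fun j => amplitude R m (f j) (2 * l + 1))
    (fun j => amplitude_ge0 R (f j) _ m0).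
  by rewrite card => /(_ _); apply; lia.
rewrite exchange_big /= mulr_natl -[X in B *+ X]card -sumr_const.
exact: ler_sum.
Qed.

(* In the next three lemmas [t] is sqrt 2 - 1, [c] is cos (pi / (2 m)), [v] is
   [t ^+ (n - 3)] and [w], [w1] are the tails of exponents [n], [n.-1]. *)
Lemma peak_gap (R : realType) (t c v w : R) :
  0 < t -> t ^+ 2 + 2 * t = 1 -> 7 / 10 <= c <= 1 -> 0 <= v ->
  t ^+ 3 * v * (1 + 5 / 4 * c) <= 1 - c -> w <= t * v * (4 / 5) ->
  2 * (4 * c ^+ 3 - 3 * c) + w <= 2 * c - w.
Proof.
move=> t0 tE /andP[c7 c1] v0 H Hw.
have t_ge : 12 / 29 <= t by nra.
have t_le : t <= 29 / 70 by nra.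
have tv0 : 0 <= t * v by rewrite mulr_ge0 // ltW.
have H1 : (t * v) * (17 / 100) <= t ^+ 3 * v.
  have -> : t ^+ 3 * v = (t * v) * t ^+ 2 by ring.
  by rewrite ler_wpM2l //; lra.
have H2 : (t * v) * (17 / 100) * (15 / 8) <= 1 - c.
  apply: le_trans H; rewrite ler_pM //; [by rewrite mulr_ge0 | lra].
(* 2 cos y - 2 cos (3 y) factors as 8 (1 - c) c (1 + c), and c (1 + c) >= 1 in this range. *)
have H3 : (1 - c) * (8 * (c * (1 + c))) >= (1 - c) * 8.
  rewrite ler_wpM2l //; [lra | nra].
have -> : 2 * c - w = 2 * (4 * c ^+ 3 - 3 * c) + (1 - c) * (8 * (c * (1 + c))) - w by ring.
lra.
Qed.

Lemma nonpeak_gap (R : realType) (t c v w w1 : R) :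
  0 < t -> t ^+ 2 + 2 * t = 1 -> 92 / 100 <= c <= 1 -> 0 <= v ->
  t ^+ 3 * v * (1 + 5 / 4 * c) <= 1 - c -> w <= t * v * (4 / 5) ->
  0 <= w1 <= v * (4 / 5) ->
  (4 * c ^+ 2 - 3) * (2 + w1) <= 2 * c - w.
Proof.
move=> t0 tE /andP[c9 c1] v0 H Hw /andP[w10 Hw1].
have t_ge : 12 / 29 <= t by nra.
have t_le : t <= 1 / 2 by nra.
have t3 : 7 / 100 <= t ^+ 3.
  have -> : t ^+ 3 = t * (1 - 2 * t) by rewrite -[X in X - 2 * t]tE; ring.
  nra.
have H1 : (7 / 100) * v <= t ^+ 3 * v by rewrite ler_wpM2r.
have H2 : (7 / 100) * v * (215 / 100) <= 1 - c.
  apply: le_trans H; rewrite ler_pM //; [by rewrite mulr_ge0 | lra].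
have tv : t * v <= v / 2 by nra.
have Hq : (4 * c ^+ 2 - 3) * w1 <= w1 by rewrite ler_piMl //; nra.
have Hc : (1 - c) * (6 + 66 / 10) <= (1 - c) * (2 * (4 * c + 3)).
  by rewrite ler_wpM2l //; lra.
have -> : (4 * c ^+ 2 - 3) * (2 + w1) =
  2 * c - (1 - c) * (2 * (4 * c + 3)) + (4 * c ^+ 2 - 3) * w1 by ring.
lra.
Qed.

Lemma mixed_gap (R : realType) (t c v w w1 : R) :
  0 < t -> t ^+ 2 + 2 * t = 1 -> 92 / 100 <= c -> 0 <= v <= t ^+ 2 ->
  w <= t * v * (4 / 5) -> w1 <= v * (4 / 5) ->
  5 / 4 * t * (2 + w1) <= 2 * c - w.
Proof.
move=> t0 tE c9 /andP[v0 vt] Hw Hw1.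
have t_le : t <= 1 / 2 by nra.
have v_le : v <= 1 / 4 by nra.
have tv : t * v <= v / 2 by nra.
have : t * (2 + w1) <= t * (2 + 1 / 5) by rewrite ler_wpM2l ?(ltW t0) //; lra.
lra.
Qed.

(** When [P] is 1 or -1 modulo [4 * m] the sum is the formula itself; otherwise its leading term is
    at most 2 cos (3 y), and the last hypothesis absorbs both tails. *)
Lemma peaked_prod_le (R : realType) x m n (f : 'I_n -> nat -> bool) g :
  m = (2 ^ x)%N -> (1 < m)%N -> odd n -> odd g ->
  (forall j, peaked R m (f j) g) ->
  2 * cos (3 * hstep R m) + tail R m n <= 2 * cos (hstep R m) - tail R m n ->
  complex.Re (\sum_(l < m) \prod_(j < n) fourier R m (f j) (2 * l + 1))
    <= peak_sum R m n 1.
Proof.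
move=> mE m1 on og /choice[r Hr] gap; have m0 : (0 < m)%N by lia.
have em : ~~ odd m by rewrite mE oddX; case: x mE => [|x] //= mE; rewrite mE in m1.
have s0 : 0 < sin (hstep R m) := sin_hstep1_gt0 R m0.
rewrite (same_peak_sum mE m0 on og Hr); set P := (_ + _)%N.
have oP : odd P by rewrite oddD !oddM on /= addbF; lia.
have peak_eq : (P %% (4 * m) = 1)%N \/ (P %% (4 * m) = 4 * m - 1)%N ->
    peak_sum R m n P = peak_sum R m n 1.
  move=> HP; apply: eq_bigr => l _; congr (_ * (_ / _)).
  by rewrite (cos_peak_eq R _ m0 HP) mulr1.
have [HP|[HP|HP]] := cos_peak_le R m1 oP.
- by rewrite peak_eq //; left.
- by rewrite peak_eq //; right.
have sn : 0 < sin (hstep R m) ^+ n by rewrite exprn_gt0.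
rewrite -(ler_pM2l sn).
have := peak_sum_near R n m1 em oP; have := peak_sum_near R n m1 em (isT : odd 1).
rewrite !ler_norml mul1r => /andP[A _] /andP[_ B]; lra.
Qed.

Lemma mermin_sum_le (R : realType) x m n (f : 'I_n -> nat -> bool) :
  m = (2 ^ x)%N -> (1 < m)%N -> odd n -> n_odd R m <= n%:Z ->
  (forall j, antiperiodic m (f j)) ->
  complex.Re (\sum_(l < m) \prod_(j < n) fourier R m (f j) (2 * l + 1))
    <= peak_sum R m n 1.
Proof.
move=> mE m1 on hn fm; have m0 : (0 < m)%N by lia.
have em : ~~ odd m by rewrite mE oddX; case: x mE => [|x] //= mE; rewrite mE in m1.
move: hn; rewrite /n_odd !ge_max => /and3P[hev _ hodd2].
have tn := n_odd2_le m1 hodd2.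
have [n3 n4] := n_ge m1 tn.
have [t0 tE] := tan_pi8 R.
have s0 : 0 < sin (hstep R m) := sin_hstep1_gt0 R m0.
have c7 := cos_hstep_ge2 R m1; have c1 := cos_le1 (hstep R m).
have qE : 1 - 4 * sin (hstep R m) ^+ 2 = 4 * cos (hstep R m) ^+ 2 - 3.
  by have := cos2Dsin2 (hstep R m); lra.
set t := tan (pi / 8) in tn t0 tE *; set c := cos (hstep R m) in tn c7 c1 qE *.
pose v : R := t ^+ (n - 3).
have v0 : 0 <= v by rewrite exprn_ge0 // ltW.
have nk : n = (n - 3).+3 by rewrite -addn3 subnK.
have tvn : t ^+ n = t ^+ 3 * v by rewrite -exprD subnKC.
rewrite tvn in tn.
have /andP[D0 D1] := tail2_le R mE m1.
have tail_n : tail R m n <= t * v * (4 / 5).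
  have /andP[_] := tail_le R (n - 3).+1 mE m1; rewrite -nk => /le_trans; apply.
  by rewrite exprS ler_wpM2l // mulr_ge0 // ltW.
have tail_n1 : 0 <= tail R m n.-1 <= v * (4 / 5).
  have /andP[A B] := tail_le R (n - 3) mE m1.
  have -> : n.-1 = (n - 3).+2 by clear -n3; lia.
  by rewrite A (le_trans B) // ler_wpM2l.
have gapA : 2 * cos (3 * hstep R m) + tail R m n <= 2 * c - tail R m n.
  by rewrite cos3x; apply: (peak_gap t0 tE) tn tail_n => //; rewrite c7.
case: (pselect (exists2 g, odd g & forall j, peaked R m (f j) g)) => [[g og Hg]|nog].
  exact: (peaked_prod_le mE m1 on og Hg gapA).
have np g : odd g -> exists j, ~ peaked R m (f j) g.
  by move=> og; apply/existsNP => H; apply: nog; exists g.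
(* Some party is not peaked at frequency 1; this excludes m = 2, and parity improves [4 <= n] to
   [5 <= n]. *)
have [j0 Hj0] := np 1%N isT.
have [m3 _] := not_peaked_le mE m1 (fm j0) (isT : odd 1) Hj0.
have n5 : (5 <= n)%N by have := n4 m3; case: (ltngtP n 4) => // E; move: on; rewrite E.
have c9 : 92 / 100 <= c := cos_hstep_ge4 R m3.
have n1 : (1 < n)%N by clear -n3; lia.
have sn : 0 < sin (hstep R m) ^+ n by rewrite exprn_gt0.
rewrite -(ler_pM2l sn); apply: le_trans (Re_prod_le R f m0) _.
have low : 2 * c - tail R m n <= sin (hstep R m) ^+ n * peak_sum R m n 1.
  have := peak_sum_near R n m1 em (isT : odd 1).
  by rewrite ler_norml mul1r -/c => /andP[A _]; lra.
apply: le_trans low.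
(* No party exceeds the power sum of a peaked vector; for those peaked nowhere this is due to
   [n_even]. *)
have bnd j : \sum_(l < m) amplitude R m (f j) (2 * l + 1) ^+ n.-1 <= 2 + tail R m n.-1.
  case: (pselect (exists2 g, odd g & peaked R m (f j) g)) => [[g og Hg]|nj].
    by rewrite (peaked_sum n.-1 mE m1 og Hg).
  have {}nj g : odd g -> ~ peaked R m (f j) g by move=> og Hg; apply: nj; exists g.
  have -> : n.-1 = (n - 3).+2 by clear -n3; lia.
  apply: le_trans (not_peaked_sum (n - 3) mE m1 (fm j) nj) _.
  apply: le_trans (n_even_le m3 hev n3) _.
  by rewrite lerDl; have /andP[] := tail_le R (n - 3) mE m1.
have amp0 j l : 0 <= amplitude R m (f j) (2 * l + 1) by exact: amplitude_ge0.
(* If party [k] peaks nowhere, it contributes at most the gap factor at every frequency, and AM-GM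
   bounds the others. *)
case: (pselect (exists k, forall g, odd g -> ~ peaked R m (f k) g)) => [[k Hk]|npk].
  apply: le_trans (nonpeak_gap t0 tE _ v0 tn tail_n tail_n1); last by rewrite c9.
  rewrite -qE; apply: (@le_trans _ _ ((1 - 4 * sin (hstep R m) ^+ 2) *
    \sum_(l < m) \prod_(j < n | j != k) amplitude R m (f j) (2 * l + 1))).
    rewrite mulr_sumr; apply: ler_sum => l _; rewrite (bigD1 k) //= ler_wpM2r //.
      by apply: prodr_ge0.
    by have [] := not_peaked_le mE m1 (fm k) (odd_2l1 l) (Hk _ (odd_2l1 l)).
  by rewrite ler_wpM2l ?gap_ge0 // sum_prod_fixed_le.
have /choice[k Hk] : forall l : 'I_m, exists j, ~ peaked R m (f j) (2 * l + 1).
  by move=> l; apply: np; exact: odd_2l1.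
have vt : 0 <= v <= t ^+ 2.
  by rewrite v0 ler_wiXn2l ?(ltW t0) //; [nra | clear -n5; lia].
apply: le_trans (mixed_gap t0 tE c9 vt tail_n (proj2 (andP tail_n1))).
(* At each frequency some party is off its peak, which gains a factor [t]; AM-GM
   on the others loses at most [n / n.-1 <= 5 / 4]. *)
have others := sum_prod_others_le k n1 m0 bnd.
apply: (@le_trans _ _ (t * \sum_(l < m) \prod_(j < n | j != k l) amplitude R m (f j) (2 * l + 1))).
  rewrite mulr_sumr; apply: ler_sum => l _; rewrite (bigD1 (k l)) //= ler_wpM2r //.
    by apply: prodr_ge0.
  have [g og Hg] : exists2 g, odd g & peaked R m (f (k l)) g.
    by apply: contrapT => H; apply: npk; exists (k l) => g og Hg; apply: H; exists g.
  exact: off_peak_le mE m1 (fm (k l)) og (odd_2l1 l) Hg (Hk l).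
have -> : 5 / 4 * t * (2 + tail R m n.-1) = t * (5 / 4 * (2 + tail R m n.-1)) by ring.
rewrite ler_wpM2l ?(ltW t0) //.
have nr : n.-1%:R = n%:R - 1 :> R by rewrite -subn1 natrB // ltnW.
have n5R : 5 <= n%:R :> R by rewrite (ler_nat R 5).
move: others; rewrite nr; set S := \sum_(l < m) _; set B := 2 + _ => others.
have B0 : 0 <= B by rewrite addr_ge0 //; case/andP: tail_n1.
have n1R : 0 < n%:R - 1 :> R by lra.
rewrite -(ler_pM2l n1R); apply: le_trans others _.
rewrite mulrA ler_wpM2r //; lra.
Qed.

(** Translating the constant strategy of a single party brings [P] to 1 modulo [4 * m]. *)
Lemma peak_sum_attained (R : realType) x m n : m = (2 ^ x)%N -> (1 < m)%N -> odd n ->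
  exists a : strategies m n, complex.Re (\sum_(l < m)
    \prod_(j < n) fourier R m (unroll (a j)) (2 * l + 1)) = peak_sum R m n 1.
Proof.
move=> mE m1 on; have m0 : (0 < m)%N by lia.
have em : ~~ odd m by rewrite mE oddX; case: x mE => [|x] //= mE; rewrite mE in m1.
have n0 : (0 < n)%N by case: n on.
pose j0 := Ordinal n0.
(* As n (m - 1) + n (3 m + 1) = 4 m n, this gives P = 4 m n + 1; the division is exact since n and 3
   m + 1 are odd. *)
pose q := ((1 + n * (3 * m + 1)) %/ 2)%N.
have qE : (2 * q = 1 + n * (3 * m + 1))%N.
  rewrite mulnC divnK // dvdn2 oddD oddM oddD oddM on (negbTE em) //.
pose r (j : 'I_n) := if j == j0 then q else 0%N.
(* Adding [r j * (2 * m).-1] is a translation by [- r j] modulo [2 * m] within the natural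
   numbers. *)
pose a : strategies m n := [ffun j => [ffun i : 'I_m => ones m (i + r j * (2 * m).-1)]].
have om := antiperiodic_ones m0.
have aE j k : unroll (a j) k = ones m (k + r j * (2 * m).-1).
  move: k; apply: (eq_antiperiodic m0); first exact: antiperiodic_unroll.
    by move=> k; rewrite addnAC om.
  by move=> k km; rewrite -[k]/(val (Ordinal km)) unroll_ord !ffunE.
exists a.
have Hr j h : odd h -> fourier R m (unroll (a j)) (1 * h) =
    expi (2 * hstep R m * (h * r j)%:R) * fourier R m (ones m) h.
  move=> oh; rewrite mul1n (@fourier_shift R m _ h (r j)) //; last exact: antiperiodic_unroll.
  congr (_ * _); apply: eq_fourier => k; rewrite aE.
  have -> : (k + r j + r j * (2 * m).-1 = k + (r j * 2) * m)%N.
    rewrite -addnA -mulnS prednK ?mulnA //; lia.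
  by rewrite antiperiodicM // oddM andbF.
rewrite (same_peak_sum mE m0 on (isT : odd 1) Hr).
have -> : (\sum_(j < n) r j = q)%N by rewrite -big_mkcond big_pred1_eq.
apply: eq_bigr => l _; congr (_ * (_ / _)).
rewrite mulr1; apply: cos_peak_eq => //; left.
have -> : (n * m.-1 + 2 * q = n * (4 * m) + 1)%N.
  rewrite qE addnCA -mulnDr addnC; congr (n * _ + 1)%N; clear -m0; lia.
by rewrite modnMDl modn_small //; lia.
Qed.

Theorem proposition2 (R : realType) (m x : nat) (hm : m = (2 ^ x)%N)
    (hm2 : (2 <= m)%N) (n : nat) (hodd : odd n) (hn : n_odd R m <= n%:Z) :
  local_bound R m n =
  2 / m%:R ^+ n *
  \sum_(j < (m %/ 2)%N)
     (-1) ^+ j * (cos ((2 * j%:R + 1) * pi / (2 * m%:R))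
                  / sin ((2 * j%:R + 1) * pi / (2 * m%:R)) ^+ n).
Proof.
have m0 : (0 < m)%N by lia.
have n0 : (0 < n)%N by case: n hodd {hn}.
have m2 : (2 %| m)%N.
  by rewrite hm; case: x hm => [|x] E; [rewrite E in hm2 | rewrite expnS dvdn_mulr].
have mn : 0 < (m%:R ^+ n)^-1 :> R by rewrite invr_gt0 exprn_gt0 // ltr0n.
rewrite [2 / _]mulrC -mulrA -half_sum // /local_bound.
have [a0 Ha0] := peak_sum_attained R hm hm2 hodd.
case: arg_maxP => // a _ amax; apply/le_anti/andP; split.
  rewrite mermin_fourier // ler_pM2l //.
  by apply: (mermin_sum_le hm) => // j; exact: antiperiodic_unroll.
by rewrite -Ha0 -mermin_fourier //; exact: amax.
Qed.
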